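(* Let $k$ be a field, let $C$ be a coalgebra over $k$, let $A$ be its profinite dual algebra, let $M$ be a right $C$-comodule and $N$ a left $C$-comodule. Then $$\operatorname{Cotor}_C^*(M,N)\;\cong\; H^*_{\mathrm{ctn}}(A, M\otimes N).$$
   Context: $\otimes=\otimes_k$. $C$ is the directed union of its finite-dimensional subcoalgebras $C^\alpha$; put $A_\alpha=\operatorname{Hom}_k(C^\alpha,k)$, a finite-dimensional algebra. The profinite dual of $C$ is $A=\operatorname{Hom}_k(C,k)=\varprojlim A_\alpha$ together with the inverse system $\{A_\alpha\}$; $A_\alpha=A/I_\alpha$, where $I_\alpha$ is the ideal of functions vanishing on $C^\alpha$. A right $C$-comodule $M$ is a left $A$-module by $a\cdot m=\sum m_0\,a(m_1)$, where $\Delta_M(m)=\sum m_0\otimes m_1\in M\otimes C$; similarly a left $C$-comodule $N$ is a right $A$-module. $M\otimes N$ is the $A$-bimodule with $a(m\otimes n)a'=am\otimes na'$. The cotensor product $M\square_C N$ is the kernel of $\Delta_M\otimes1-1\otimes\Delta_N\colon M\otimes N\to M\otimes C\otimes N$, and $\operatorname{Cotor}_C^*(M,N)$ denotes its right derived functors (the cohomology of the total complex of $E_1^*\square_C E_2^*$ for injective comodule resolutions $M\to E_1^*$, $N\to E_2^*$). An $A$-bimodule $B$ is rational if it is a rational module over the profinite algebra $\{A_\alpha\otimes A_\alpha^{\mathrm{op}}\}$, i.e. each element of $B$ generates a sub-bimodule that is a quotient of some $A_\alpha\otimes A_\alpha^{\mathrm{op}}$ (equivalently, for each $b\in B$ there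 is $\alpha$ with $I_\alpha b=bI_\alpha=0$). For $M$ a right $C$-comodule and $N$ a left $C$-comodule, $M\otimes N$ is a rational bimodule. The continuous Hochschild cohomology $H^*_{\mathrm{ctn}}(A,-)$ is the sequence of right derived functors, on the category of rational $A$-bimodules, of $B\mapsto \operatorname{Hom}_{A^e}(A,B)=\{b\in B: ab=ba \text{ for all } a\in A\}$, where $A^e=A\otimes A^{\mathrm{op}}$. *)

(* Defs.v *)
From HB Require Import structures.
From mathcomp Require Import all_boot all_algebra.
From mathcomp Require Import boolp classical_sets.
From mathcomp Require Import freeg.

Set Implicit Arguments.
Unset Strict Implicit.
Unset Printing Implicit Defensive.

Import GRing.Theory.
Local Open Scope ring_scope.
Local Open Scope quotient_scope.

Section Subspace.
Variables (k : fieldType) (V : lmodType k) (S : submodClosed V).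

Definition subsp_type : Type := {x : V | x \in S}.

HB.instance Definition _ := [isSub of subsp_type for @sval V (fun x => x \in S)].
HB.instance Definition _ := [Choice of subsp_type by <:].
HB.instance Definition _ := [SubChoice_isSubLmodule of subsp_type by <:].

Definition subsp : lmodType k := subsp_type.

Definition incl : {linear subsp -> V} := (\val : subsp_type -> V).

Definition subsp_of x (xS : x \in S) : subsp := (exist _ x xS : subsp_type).

Lemma incl_inj : injective incl. Proof. exact: val_inj. Qed.

Lemma inclP x : incl x \in S. Proof. exact: (valP (x : subsp_type)). Qed.

Lemma subsp_ofK x (xS : x \in S) : incl (subsp_of xS) = x. Proof. by []. Qed.

End Subspace.

Arguments incl {k V S}.

Section SubMap.
Variables (k : fieldType) (U V : lmodType k).
Variables (S : submodClosed U) (T : submodClosed V) (f : {linear U -> V}).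
Hypothesis fST : forall x, x \in S -> f x \in T.

Definition submap_fun (x : subsp S) : subsp T := subsp_of (fST (inclP x)).

Fact submap_linear : linear submap_fun.
Proof. by move=> a x y; apply: incl_inj; rewrite linearP !subsp_ofK !linearP. Qed.

HB.instance Definition _ :=
  GRing.isLinear.Build k (subsp S) (subsp T) *:%R submap_fun submap_linear.

Definition submap : {linear subsp S -> subsp T} := submap_fun.

Lemma submapE x : incl (submap x) = f (incl x). Proof. by []. Qed.

End SubMap.

Section QuotientSpace.
Variables (k : fieldType) (V : lmodType k) (S : submodClosed V).

Fact subspace_closedB : zmod_closed S.
Proof. by split=> [|x y xS yS]; rewrite ?rpred0 // -scaleN1r rpredD ?rpredZ. Qed.

Definition subspace_zmod : zmodClosed V :=
  HB.pack_for (zmodClosed V) (fun x : V => x \in S)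
    (GRing.isZmodClosed.Build V (fun x : V => x \in S) subspace_closedB).

Definition quotsp_type : Type := Quotient.quot subspace_zmod.

HB.instance Definition _ := EqQuotient.on quotsp_type.
HB.instance Definition _ := Choice.on quotsp_type.
HB.instance Definition _ := GRing.Zmodule.on quotsp_type.

Let pi (x : V) : quotsp_type := \pi_(Quotient.quot subspace_zmod) x.

Let piE x y : (pi x = pi y) <-> (x - y \in S).
Proof.
have -> : (x - y \in S) = (x - y \in subspace_zmod) by [].
by rewrite Quotient.idealrBE; split=> [/eqP|/eqP].
Qed.

Let piK x : pi (repr x) = x. Proof. exact: reprK. Qed.

Let piD x y : pi (x + y) = pi x + pi y.
Proof. exact: (Quotient.pi_add subspace_zmod). Qed.

Let scaleq a (x : quotsp_type) : quotsp_type := pi (a *: repr x).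

Let scaleqE a x : scaleq a (pi x) = pi (a *: x).
Proof. by apply/piE; rewrite -scalerBr rpredZ //; apply/piE; rewrite piK. Qed.

Let scaleqA a b x : scaleq a (scaleq b x) = scaleq (a * b) x.
Proof. by rewrite -[x]piK !scaleqE scalerA. Qed.

Let scale1q x : scaleq 1 x = x.
Proof. by rewrite -[x]piK scaleqE scale1r. Qed.

Let scaleqDr : right_distributive scaleq +%R.
Proof.
by move=> a x y; rewrite -[x]piK -[y]piK -piD !scaleqE scalerDr piD.
Qed.

Let scaleqDl x : {morph scaleq^~ x : a b / a + b}.
Proof. by move=> a b; rewrite -[x]piK !scaleqE scalerDl piD. Qed.

HB.instance Definition _ := GRing.Zmodule_isLmodule.Build k quotsp_type
  scaleqA scale1q scaleqDr scaleqDl.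

Definition quotsp : lmodType k := quotsp_type.

Definition qproj_fun (x : V) : quotsp := pi x.

Fact qproj_linear : linear qproj_fun.
Proof. by move=> a x y; rewrite /qproj_fun piD -scaleqE. Qed.

HB.instance Definition _ :=
  GRing.isLinear.Build k V quotsp *:%R qproj_fun qproj_linear.

Definition qproj : {linear V -> quotsp} := qproj_fun.

Lemma qproj_eq x y : qproj x = qproj y <-> x - y \in S.
Proof. exact: piE. Qed.

Lemma qproj_surj (y : quotsp) : exists x, y = qproj x.
Proof. by exists (repr y); rewrite [RHS]piK. Qed.

End QuotientSpace.

Section Product.
Variables (k : fieldType) (I : Type) (V : I -> lmodType k).

Definition dprod_type : Type := forall i, V i.

HB.instance Definition _ := gen_eqMixin dprod_type.
HB.instance Definition _ := gen_choiceMixin dprod_type.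

Implicit Types f g h : dprod_type.
Let zero : dprod_type := fun _ => 0.
Let opp f : dprod_type := fun i => - f i.
Let add f g : dprod_type := fun i => f i + g i.
Let scale a f : dprod_type := fun i => a *: f i.

Let addA : associative add.
Proof. by move=> f g h; apply: functional_extensionality_dep => i; exact: addrA. Qed.
Let addC : commutative add.
Proof. by move=> f g; apply: functional_extensionality_dep => i; exact: addrC. Qed.
Let add0 : left_id zero add.
Proof. by move=> f; apply: functional_extensionality_dep => i; exact: add0r. Qed.
Let addN : left_inverse zero opp add.
Proof. by move=> f; apply: functional_extensionality_dep => i; exact: addNr. Qed.

HB.instance Definition _ := GRing.isZmodule.Build dprod_type addA addC add0 addN.

Let scaleA a b f : scale a (scale b f) = scale (a * b) f.
Proof. by apply: functional_extensionality_dep => i; exact: scalerA. Qed.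
Let scale1 f : scale 1 f = f.
Proof. by apply: functional_extensionality_dep => i; exact: scale1r. Qed.
Let scaleDr : right_distributive scale +%R.
Proof. by move=> a f g; apply: functional_extensionality_dep => i; exact: scalerDr. Qed.
Let scaleDl f : {morph scale^~ f : a b / a + b}.
Proof. by move=> a b; apply: functional_extensionality_dep => i; exact: scalerDl. Qed.

HB.instance Definition _ := GRing.Zmodule_isLmodule.Build k dprod_type
  scaleA scale1 scaleDr scaleDl.

Definition dprod : lmodType k := dprod_type.

End Product.

Section Span.
Variables (k : fieldType) (V : lmodType k) (P : set V).

Definition span_pred : {pred V} := fun x =>
  `[< forall S : submodClosed V, (forall y, P y -> y \in S) -> x \in S >].

Fact span_submod : submod_closed span_pred.
Proof.
split=> [|a x y /asboolP xP /asboolP yP]; apply/asboolP => S PS; first exact: rpred0.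
by apply: rpredD; [apply/rpredZ/xP|apply: yP].
Qed.

HB.instance Definition _ := GRing.isSubmodClosed.Build k V span_pred span_submod.

Definition span : submodClosed V := span_pred.

End Span.

Section Kernel.
Variables (k : fieldType) (U V : lmodType k) (f : {linear U -> V}).

Definition ker_pred : {pred U} := fun x => f x == 0.

Fact ker_submod : submod_closed ker_pred.
Proof.
split=> [|a x y /eqP xK /eqP yK]; apply/eqP; first exact: linear0.
by rewrite linearP xK yK scaler0 addr0.
Qed.

HB.instance Definition _ := GRing.isSubmodClosed.Build k U ker_pred ker_submod.

Definition ker : submodClosed U := ker_pred.

Lemma kerP x : x \in ker <-> f x = 0.
Proof. by split=> /eqP. Qed.

End Kernel.

Lemma ker_subP (k : fieldType) (U V : lmodType k) (f g : {linear U -> V}) x :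
  x \in ker (f \- g) <-> f x = g x.
Proof.
split=> [/kerP fg|fg]; first by apply/eqP; rewrite -subr_eq0; apply/eqP.
by apply/kerP; rewrite /= fg subrr.
Qed.

Definition lin_iso (k : fieldType) (U V : lmodType k) : Prop :=
  exists f : {linear U -> V}, bijective f.

Section Tensor.
Variables (k : fieldType) (V W : lmodType k).

Let F : lmodType k := {freeg (V * W)%type / k}.
Let g (v : V) (w : W) : F := << (v, w) >>.

Definition bilinear_relator : set F := fun x =>
  (exists a v v' w, x = g (a *: v + v') w - (a *: g v w + g v' w)) \/
  (exists a v w w', x = g v (a *: w + w') - (a *: g v w + g v w')).

Definition tensor : lmodType k := quotsp (span bilinear_relator).

Definition tens (v : V) (w : W) : tensor := qproj (span bilinear_relator) (g v w).

Fact tens_bilinear : bilinear_for *:%R *:%R tens.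
Proof.
by split=> [w|v] a x y; rewrite /tens -(linearP (qproj _)); apply/qproj_eq/asboolP => S;
  apply; [left; exists a, x, y, w|right; exists a, v, x, y].
Qed.

HB.instance Definition _ :=
  bilinear_isBilinear.Build k V W tensor *:%R *:%R tens tens_bilinear.

End Tensor.

Section TensorLift.
Variables (k : fieldType) (V W U : lmodType k) (f : {bilinear V -> W -> U}).

Let f' (x : V * W) : U := f x.1 x.2.
Let F : lmodType k := {freeg (V * W)%type / k}.

Fact freeg_lift_linear : linear (fglift f' : F -> U).
Proof.
move=> a x y; have fD := lift_is_additive f'.
have f0 : fglift f' (0 : F) = 0 by rewrite -(subrr (0 : F)) fD subrr.
have fN u : fglift f' (- u : F) = - fglift f' u by rewrite -[- u]sub0r fD f0 sub0r.
have {fD}fD u v : fglift f' (u + v : F) = fglift f' u + fglift f' v.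
  by rewrite -[v]opprK fD !fN.
have fS (J : Type) (r : seq J) (G : J -> F) :
    fglift f' (\sum_(j <- r) G j) = \sum_(j <- r) fglift f' (G j).
  by elim/big_rec2: _ => // j _ z _ <-; rewrite fD.
rewrite fD; congr (_ + _); rewrite -[x in LHS]freeg_sumE -[x in RHS]freeg_sumE.
rewrite scaler_sumr !fS scaler_sumr; apply: eq_bigr => z _.
have -> : a *: (<< coeff z x *g z >> : F) = << a * coeff z x *g z >>.
  by apply/eqP/freeg_eqP => u; rewrite coeffZ !coeffU mulrA.
by rewrite !liftU scalerA.
Qed.

HB.instance Definition _ :=
  GRing.isLinear.Build k F U *:%R (fglift f' : F -> U) freeg_lift_linear.

Definition freeg_lift : {linear F -> U} := (fglift f' : F -> U).

Fact freeg_lift_relator x : x \in span (@bilinear_relator k V W) -> freeg_lift x = 0.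
Proof.
move=> /asboolP /(_ (ker freeg_lift)) xK; apply/kerP/xK => y yR.
have gE v w : freeg_lift << (v, w) >> = f v w by rewrite [LHS]liftU scale1r.
apply/kerP; case: yR => [[a [v [v' [w ->]]]]|[a [v [w [w' ->]]]]].
  by rewrite linearB linearP !gE linearPl subrr.
by rewrite linearB linearP !gE linearPr subrr.
Qed.

Definition tlift_fun (t : tensor V W) : U := freeg_lift (repr t).

Fact tlift_qproj x : tlift_fun (qproj (span (@bilinear_relator k V W)) x) = freeg_lift x.
Proof.
apply/eqP; rewrite -subr_eq0 -linearB; apply/eqP/freeg_lift_relator/qproj_eq.
exact: reprK.
Qed.

Fact tlift_linear : linear tlift_fun.
Proof.
move=> a t u; have [x ->] := qproj_surj t; have [y ->] := qproj_surj u.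
by rewrite -[_ *: _ + _]linearP !tlift_qproj linearP.
Qed.

HB.instance Definition _ :=
  GRing.isLinear.Build k (tensor V W) U *:%R tlift_fun tlift_linear.

Definition tlift : {linear tensor V W -> U} := tlift_fun.

Lemma tliftE v w : tlift (tens v w) = f v w.
Proof. by rewrite [LHS]tlift_qproj [LHS]liftU scale1r. Qed.

End TensorLift.

Lemma tens_eq (k : fieldType) (V W U : lmodType k) (f g : {linear tensor V W -> U}) :
  (forall v w, f (tens v w) = g (tens v w)) -> f =1 g.
Proof.
move=> fg t; have [x ->] := qproj_surj t.
pose F : lmodType k := {freeg (V * W)%type / k}.
rewrite -[x]freeg_sumE !linear_sum /=; apply: eq_bigr => -[v w] _ /=.
set c := coeff _ _.
have -> : (<< c *g (v, w) >> : F) = c *: << (v, w) >>.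
  by apply/eqP/freeg_eqP => u; rewrite coeffZ !coeffU mul1r.
by rewrite !linearZ; congr (_ *: _); apply: fg.
Qed.

Section TensorMap.
Variables (k : fieldType) (V W V' W' : lmodType k).
Variables (f : {linear V -> V'}) (g : {linear W -> W'}).

Definition tmap_fun v w : tensor V' W' := tens (f v) (g w).

Fact tmap_bilinear : bilinear_for *:%R *:%R tmap_fun.
Proof. by split=> x a y z; rewrite /tmap_fun linearP (linearPl, linearPr). Qed.

HB.instance Definition _ :=
  bilinear_isBilinear.Build k V W (tensor V' W') *:%R *:%R tmap_fun tmap_bilinear.

Definition tmap : {linear tensor V W -> tensor V' W'} := tlift tmap_fun.

Lemma tmapE v w : tmap (tens v w) = tens (f v) (g w).
Proof. exact: tliftE. Qed.

End TensorMap.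

Section TensorAssoc.
Variables (k : fieldType) (U V W : lmodType k).

Definition tassoc_in w u v : tensor U (tensor V W) := tens u (tens v w).

Fact tassoc_in_bilinear w : bilinear_for *:%R *:%R (tassoc_in w).
Proof.
by split=> x a y z; rewrite /tassoc_in ?linearPl // ?linearPr.
Qed.

HB.instance Definition _ w := bilinear_isBilinear.Build k U V
  (tensor U (tensor V W)) *:%R *:%R (tassoc_in w) (tassoc_in_bilinear w).

Definition tassoc_out t w := tlift (tassoc_in w) t.

Fact tassoc_out_bilinear : bilinear_for *:%R *:%R tassoc_out.
Proof.
split=> [w|t] a x y; first exact: linearP.
rewrite /tassoc_out.
pose h : tensor U V -> tensor U (tensor V W) :=
  fun t => a *: tlift (tassoc_in x) t + tlift (tassoc_in y) t.
have h_linear : linear h.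
  move=> b z z'; rewrite /h (linearP (tlift (tassoc_in x))) (linearP (tlift (tassoc_in y))).
  rewrite !scalerDr addrACA; congr (_ + _).
  by rewrite !scalerA mulrC.
pose hL : {linear tensor U V -> tensor U (tensor V W)} :=
  HB.pack_for {linear tensor U V -> tensor U (tensor V W)} h
    (GRing.isLinear.Build k _ _ *:%R h h_linear).
apply: (@tens_eq _ _ _ _ (tlift (tassoc_in (a *: x + y))) hL) => u v.
rewrite [RHS]/(h _) /h !tliftE.
rewrite -[LHS]/(tens u (tens v (a *: x + y))).
by rewrite linearPr linearPr.
Qed.

HB.instance Definition _ := bilinear_isBilinear.Build k (tensor U V) W
  (tensor U (tensor V W)) *:%R *:%R tassoc_out tassoc_out_bilinear.

Definition tassoc : {linear tensor (tensor U V) W -> tensor U (tensor V W)} :=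
  tlift tassoc_out.

Lemma tassocE u v w : tassoc (tens (tens u v) w) = tens u (tens v w).
Proof. by rewrite [LHS]tliftE [LHS]tliftE. Qed.

End TensorAssoc.

Arguments tassoc {k U V W}.

Section Contraction.
Variables (k : fieldType) (V W : lmodType k).

Definition contr_l_fun (a : {scalar V}) v w : W := a v *: w.

Fact contr_l_bilinear a : bilinear_for *:%R *:%R (contr_l_fun a).
Proof.
split=> [w|v] b x y; rewrite /contr_l_fun; first by rewrite linearP scalerDl -scalerA.
rewrite -[RHS]/(b *: (a v *: x) + a v *: y).
by rewrite scalerDr !scalerA mulrC.
Qed.

HB.instance Definition _ a :=
  bilinear_isBilinear.Build k V W W *:%R *:%R (contr_l_fun a) (contr_l_bilinear a).

Definition contr_l a : {linear tensor V W -> W} := tlift (contr_l_fun a).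

Lemma contr_lE a v w : contr_l a (tens v w) = a v *: w.
Proof. exact: tliftE. Qed.

Definition contr_r_fun (a : {scalar W}) v w : V := a w *: v.

Fact contr_r_bilinear a : bilinear_for *:%R *:%R (contr_r_fun a).
Proof.
split=> [w|v] b x y; rewrite /contr_r_fun; last by rewrite linearP scalerDl -scalerA.
rewrite -[RHS]/(b *: (a w *: x) + a w *: y).
by rewrite scalerDr !scalerA mulrC.
Qed.

HB.instance Definition _ a :=
  bilinear_isBilinear.Build k V W V *:%R *:%R (contr_r_fun a) (contr_r_bilinear a).

Definition contr_r a : {linear tensor V W -> V} := tlift (contr_r_fun a).

Lemma contr_rE a v w : contr_r a (tens v w) = a w *: v.
Proof. exact: tliftE. Qed.

End Contraction.

Arguments contr_l {k V W} a.
Arguments contr_r {k V W} a.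

Section TensorMapTheory.
Variable k : fieldType.

Lemma tmap_comp (V W V' W' V'' W'' : lmodType k)
    (f : {linear V -> V'}) (g : {linear W -> W'})
    (f' : {linear V' -> V''}) (g' : {linear W' -> W''}) t :
  tmap f' g' (tmap f g t) = tmap (f' \o f) (g' \o g) t.
Proof.
apply: (tens_eq (f := tmap f' g' \o tmap f g)) => v w.
change (tmap f' g' (tmap f g (tens v w)) = tmap (f' \o f) (g' \o g) (tens v w)).
by rewrite !tmapE.
Qed.

Lemma eq_tmap (V W V' W' : lmodType k) (f f' : {linear V -> V'})
    (g g' : {linear W -> W'}) :
  f =1 f' -> g =1 g' -> tmap f g =1 tmap f' g'.
Proof. by move=> ff' gg'; apply: tens_eq => v w; rewrite !tmapE ff' gg'. Qed.

Lemma tmap_id (V W : lmodType k) (t : tensor V W) : tmap idfun idfun t = t.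
Proof. by apply: (tens_eq (g := idfun)) => v w; rewrite tmapE. Qed.

Lemma tens_eq3 (U V W X : lmodType k) (f g : {linear tensor (tensor U V) W -> X}) :
  (forall u v w, f (tens (tens u v) w) = g (tens (tens u v) w)) -> f =1 g.
Proof.
move=> fg; apply: tens_eq => t w.
apply: (tens_eq (f := f \o applyr (@tens k (tensor U V) W) w)
                (g := g \o applyr (@tens k (tensor U V) W) w)) => u v.
exact: fg.
Qed.

Lemma tassoc_nat (U V W U' V' W' : lmodType k) (f : {linear U -> U'})
    (g : {linear V -> V'}) (h : {linear W -> W'}) t :
  tassoc (tmap (tmap f g) h t) = tmap f (tmap g h) (tassoc t).
Proof.
apply: (tens_eq3 (f := tassoc \o tmap (tmap f g) h)
                 (g := tmap f (tmap g h) \o tassoc)) => u v w.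
change (tassoc (tmap (tmap f g) h (tens (tens u v) w)) =
        tmap f (tmap g h) (tassoc (tens (tens u v) w))).
by rewrite tassocE !tmapE tassocE.
Qed.

End TensorMapTheory.

Section ContractionTheory.
Variable k : fieldType.

Lemma contr_r_tmap (V W V' W' : lmodType k) (f : {linear V -> V'}) (g : {linear W -> W'})
    (a : {scalar W'}) t :
  contr_r a (tmap f g t) = f (contr_r (a \o g) t).
Proof.
apply: (tens_eq (f := contr_r a \o tmap f g) (g := f \o contr_r (a \o g))) => v w.
change (contr_r a (tmap f g (tens v w)) = f (contr_r (a \o g) (tens v w))).
by rewrite tmapE !contr_rE linearZ.
Qed.

Lemma contr_l_tmap (V W V' W' : lmodType k) (f : {linear V -> V'}) (g : {linear W -> W'})
    (a : {scalar V'}) t :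
  contr_l a (tmap f g t) = g (contr_l (a \o f) t).
Proof.
apply: (tens_eq (f := contr_l a \o tmap f g) (g := g \o contr_l (a \o f))) => v w.
change (contr_l a (tmap f g (tens v w)) = g (contr_l (a \o f) (tens v w))).
by rewrite tmapE !contr_lE linearZ.
Qed.

Lemma contr_r_tassoc (U V W : lmodType k) (a : {scalar V}) (b : {scalar W})
    (t : tensor (tensor U V) W) :
  contr_r (a \o contr_r b) (tassoc t) = contr_r a (contr_r b t).
Proof.
apply: (tens_eq3 (f := contr_r (a \o contr_r b) \o tassoc)
                 (g := contr_r a \o contr_r b)) => u v w.
change (contr_r (a \o contr_r b) (tassoc (tens (tens u v) w)) =
        contr_r a (contr_r b (tens (tens u v) w))).
by rewrite tassocE !contr_rE linearZ contr_rE /= contr_rE linearZ scalerA.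
Qed.

Lemma contr_l_tassoc (U V W : lmodType k) (a : {scalar U}) (b : {scalar V})
    (t : tensor (tensor U V) W) :
  contr_l b (contr_l a (tassoc t)) = contr_l (a \o contr_r b) t.
Proof.
apply: (tens_eq3 (f := (contr_l b \o contr_l a) \o tassoc)
                 (g := contr_l (a \o contr_r b))) => u v w.
change (contr_l b (contr_l a (tassoc (tens (tens u v) w))) =
        contr_l (a \o contr_r b) (tens (tens u v) w)).
rewrite tassocE !contr_lE linearZ contr_lE.
change (a u *: (b v *: w) = a (contr_r b (tens u v)) *: w).
by rewrite contr_rE scalarZ scalerA mulrC.
Qed.

Lemma contr_lr (V W : lmodType k) (a : {scalar V}) (b : {scalar W}) (t : tensor V W) :
  a (contr_r b t) = b (contr_l a t).
Proof.
apply: (tens_eq (U := k^o) (f := (a : {linear V -> k^o}) \o contr_r b)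
                (g := (b : {linear W -> k^o}) \o contr_l a)) => v w.
change (a (contr_r b (tens v w)) = b (contr_l a (tens v w))).
by rewrite contr_rE contr_lE !scalarZ mulrC.
Qed.

Lemma contr_r_lin (V W : lmodType k) x (a b d : {scalar W}) (t : tensor V W) :
  (forall w, d w = x * a w + b w) -> contr_r d t = x *: contr_r a t + contr_r b t.
Proof.
move=> dE; apply: (tens_eq (f := contr_r d)
  (g := (x \*: contr_r a : {linear _ -> _}) \+ contr_r b)) => v w.
change (contr_r d (tens v w) = x *: contr_r a (tens v w) + contr_r b (tens v w)).
by rewrite !contr_rE dE scalerDl scalerA.
Qed.

Lemma contr_rZ (V W : lmodType k) x (a d : {scalar W}) (t : tensor V W) :
  (forall w, d w = x * a w) -> contr_r d t = x *: contr_r a t.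
Proof.
move=> dE; apply: (tens_eq (f := contr_r d)
  (g := (x \*: contr_r a : {linear _ -> _}))) => v w.
change (contr_r d (tens v w) = x *: contr_r a (tens v w)).
by rewrite !contr_rE dE scalerA.
Qed.

Lemma contr_l_lin (V W : lmodType k) x (a b d : {scalar V}) (t : tensor V W) :
  (forall v, d v = x * a v + b v) -> contr_l d t = x *: contr_l a t + contr_l b t.
Proof.
move=> dE; apply: (tens_eq (f := contr_l d)
  (g := (x \*: contr_l a : {linear _ -> _}) \+ contr_l b)) => v w.
change (contr_l d (tens v w) = x *: contr_l a (tens v w) + contr_l b (tens v w)).
by rewrite !contr_lE dE scalerDl scalerA.
Qed.

Lemma tmap_linl (V W V' W' : lmodType k) x (f f1 f2 : {linear V -> V'})
    (g : {linear W -> W'}) t :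
  (forall v, f v = x *: f1 v + f2 v) -> tmap f g t = x *: tmap f1 g t + tmap f2 g t.
Proof.
move=> fE; apply: (tens_eq (f := tmap f g)
  (g := (x \*: tmap f1 g : {linear _ -> _}) \+ tmap f2 g)) => v w.
change (tmap f g (tens v w) = x *: tmap f1 g (tens v w) + tmap f2 g (tens v w)).
by rewrite !tmapE fE linearPl.
Qed.

Lemma tmap_linr (V W V' W' : lmodType k) x (f : {linear V -> V'})
    (g g1 g2 : {linear W -> W'}) t :
  (forall w, g w = x *: g1 w + g2 w) -> tmap f g t = x *: tmap f g1 t + tmap f g2 t.
Proof.
move=> gE; apply: (tens_eq (f := tmap f g)
  (g := (x \*: tmap f g1 : {linear _ -> _}) \+ tmap f g2)) => v w.
change (tmap f g (tens v w) = x *: tmap f g1 (tens v w) + tmap f g2 (tens v w)).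
by rewrite !tmapE gE linearPr.
Qed.

Lemma tmap0l (V W V' W' : lmodType k) (f : {linear V -> V'}) (g : {linear W -> W'}) t :
  (forall v, f v = 0) -> tmap f g t = 0.
Proof.
move=> f0; apply: (tens_eq (f := tmap f g) (g := \0)) => v w.
by rewrite tmapE f0 linear0l.
Qed.

Lemma tmap0r (V W V' W' : lmodType k) (f : {linear V -> V'}) (g : {linear W -> W'}) t :
  (forall w, g w = 0) -> tmap f g t = 0.
Proof.
move=> g0; apply: (tens_eq (f := tmap f g) (g := \0)) => v w.
by rewrite tmapE g0 linear0r.
Qed.

End ContractionTheory.

#[global] Opaque tensor tens tlift tmap tassoc contr_l contr_r.

Record coalgebra (k : fieldType) := Coalgebra {
  coalg_space :> lmodType k;
  comul : {linear coalg_space -> tensor coalg_space coalg_space};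
  counit : {scalar coalg_space};
  comulA : forall c, tassoc (tmap comul idfun (comul c)) = tmap idfun comul (comul c);
  counitl : forall c, contr_l counit (comul c) = c;
  counitr : forall c, contr_r counit (comul c) = c
}.

Arguments comul {k _}.
Arguments counit {k _}.

Record rcomod (k : fieldType) (C : coalgebra k) := RComod {
  rcomod_space :> lmodType k;
  rcoact : {linear rcomod_space -> tensor rcomod_space C};
  rcoactA : forall m,
    tassoc (tmap rcoact idfun (rcoact m)) = tmap idfun comul (rcoact m);
  rcoact1 : forall m, contr_r counit (rcoact m) = m
}.

Arguments rcoact {k C _}.

Record lcomod (k : fieldType) (C : coalgebra k) := LComod {
  lcomod_space :> lmodType k;
  lcoact : {linear lcomod_space -> tensor C lcomod_space};
  lcoactA : forall n,
    tassoc (tmap comul idfun (lcoact n)) = tmap idfun lcoact (lcoact n);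
  lcoact1 : forall n, contr_l counit (lcoact n) = n
}.

Arguments lcoact {k C _}.

Definition rcomod_hom (k : fieldType) (C : coalgebra k) (M M' : rcomod C)
    (f : {linear M -> M'}) : Prop :=
  forall m, rcoact (f m) = tmap f idfun (rcoact m).

Definition lcomod_hom (k : fieldType) (C : coalgebra k) (N N' : lcomod C)
    (f : {linear N -> N'}) : Prop :=
  forall n, lcoact (f n) = tmap idfun f (lcoact n).

Section Cotensor.
Variables (k : fieldType) (C : coalgebra k).

Definition cotensor_sub (M : rcomod C) (N : lcomod C) : submodClosed (tensor M N) :=
  ker ((tassoc \o tmap (@rcoact k C M) idfun) \- tmap idfun (@lcoact k C N)).

Definition cotensor (M : rcomod C) (N : lcomod C) : lmodType k :=
  subsp (cotensor_sub M N).

Fact cotensorP (M : rcomod C) (N : lcomod C) (t : tensor M N) :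
  t \in cotensor_sub M N <-> tassoc (tmap rcoact idfun t) = tmap idfun lcoact t.
Proof. exact: ker_subP. Qed.

Fact cotensor_stable (M M' : rcomod C) (N N' : lcomod C)
    (f : {linear M -> M'}) (g : {linear N -> N'}) :
  rcomod_hom f -> lcomod_hom g -> forall t : tensor M N,
  t \in cotensor_sub M N -> tmap f g t \in cotensor_sub M' N'.
Proof.
move=> fH gH t /cotensorP tE; apply/cotensorP.
have eqL : tmap rcoact idfun (tmap f g t) = tmap (tmap f idfun) g (tmap rcoact idfun t).
  by rewrite !tmap_comp; apply: eq_tmap => // m; apply: fH.
have eqR : tmap idfun lcoact (tmap f g t) = tmap f (tmap idfun g) (tmap idfun lcoact t).
  by rewrite !tmap_comp; apply: eq_tmap => // n; apply: gH.
by rewrite eqL eqR tassoc_nat tE.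
Qed.

Definition cotensor_map (M M' : rcomod C) (N N' : lcomod C)
    (f : {linear M -> M'}) (g : {linear N -> N'})
    (fH : rcomod_hom f) (gH : lcomod_hom g) : {linear cotensor M N -> cotensor M' N'} :=
  submap (cotensor_stable fH gH).

End Cotensor.

Definition dual (k : fieldType) (C : coalgebra k) : Type := {scalar C}.

Section Dual.
Variables (k : fieldType) (C : coalgebra k).

Local Notation A := (dual C).
Implicit Types (a b : A) (c : C) (x y : k).

Definition dual_eval a : {scalar C} := a.
Local Coercion dual_eval : dual >-> GRing.Linear.type.

Fact dual_ext a b : a =1 b :> (C -> k) -> a = b.
Proof.
case: a b => f [[Df] [Sf]] [g [[Dg] [Sg]]] /= fg.
have {}fg : f = g by apply/funext => c; apply: fg.
move: Dg Sg; rewrite -{}fg => Dg Sg.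
by rewrite (Prop_irrelevance Df Dg) (Prop_irrelevance Sf Sg).
Qed.

Definition dual_of (f : C -> k) (f_lin : scalar f) : A :=
  HB.pack_for {scalar C} f (GRing.isLinear.Build k C k *%R f f_lin).

HB.instance Definition _ := gen_eqMixin A.
HB.instance Definition _ := gen_choiceMixin A.

Fact dual_zero_linear : scalar (fun _ : C => 0 : k).
Proof. by move=> x c d; rewrite mulr0 addr0. Qed.
Fact dual_opp_linear a : scalar (fun c => - a c).
Proof. by move=> x c d; rewrite linearP opprD mulrN. Qed.
Fact dual_add_linear a b : scalar (fun c => a c + b c).
Proof. by move=> x c d; rewrite !linearP mulrDr addrACA. Qed.
Fact dual_scale_linear x a : scalar (fun c => x * a c).
Proof. by move=> y c d; rewrite linearP mulrDr mulrCA. Qed.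

Definition dual_zero : A := dual_of dual_zero_linear.
Definition dual_opp a : A := dual_of (dual_opp_linear a).
Definition dual_add a b : A := dual_of (dual_add_linear a b).
Definition dual_scale x a : A := dual_of (dual_scale_linear x a).

Fact dual_addA : associative dual_add.
Proof. by move=> a b d; apply: dual_ext => c; exact: addrA. Qed.
Fact dual_addC : commutative dual_add.
Proof. by move=> a b; apply: dual_ext => c; exact: addrC. Qed.
Fact dual_add0 : left_id dual_zero dual_add.
Proof. by move=> a; apply: dual_ext => c; exact: add0r. Qed.
Fact dual_addN : left_inverse dual_zero dual_opp dual_add.
Proof. by move=> a; apply: dual_ext => c; exact: addNr. Qed.

HB.instance Definition _ :=
  GRing.isZmodule.Build A dual_addA dual_addC dual_add0 dual_addN.

Fact dual_scaleA x y a : dual_scale x (dual_scale y a) = dual_scale (x * y) a.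
Proof. by apply: dual_ext => c; exact: mulrA. Qed.
Fact dual_scale1 : left_id 1 dual_scale.
Proof. by move=> a; apply: dual_ext => c; exact: mul1r. Qed.
Fact dual_scaleDr : right_distributive dual_scale +%R.
Proof. by move=> x a b; apply: dual_ext => c; exact: mulrDr. Qed.
Fact dual_scaleDl a : {morph dual_scale^~ a : x y / x + y}.
Proof. by move=> x y; apply: dual_ext => c; exact: mulrDl. Qed.

HB.instance Definition _ := GRing.Zmodule_isLmodule.Build k A
  dual_scaleA dual_scale1 dual_scaleDr dual_scaleDl.

Fact dual_mul_linear a b : scalar (fun c => a (contr_r b (comul c))).
Proof. by move=> x c d; rewrite !linearP. Qed.

(* (a * b)(c) = \sum a(c_1) b(c_2) *)
Definition dual_mul a b : A := dual_of (dual_mul_linear a b).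
Definition dual_one : A := @counit k C.

Lemma contr_r_mul (M : rcomod C) a b (m : M) :
  contr_r (dual_mul a b) (rcoact m) = contr_r a (rcoact (contr_r b (rcoact m))).
Proof.
have -> : rcoact (contr_r b (rcoact m)) = contr_r b (tmap rcoact idfun (rcoact m)).
  by rewrite contr_r_tmap; congr (rcoact _).
rewrite -contr_r_tassoc rcoactA contr_r_tmap.
by congr (contr_r _ _); apply: dual_ext.
Qed.

Lemma contr_l_mul (N : lcomod C) a b (n : N) :
  contr_l (dual_mul a b) (lcoact n) = contr_l b (lcoact (contr_l a (lcoact n))).
Proof.
have -> : lcoact (contr_l a (lcoact n)) = contr_l a (tmap idfun lcoact (lcoact n)).
  by rewrite contr_l_tmap; congr (lcoact (contr_l _ _)); apply: dual_ext.
rewrite -lcoactA contr_l_tassoc contr_l_tmap.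
by congr (contr_l _ _); apply: dual_ext.
Qed.

Definition coalg_rcomod : rcomod C :=
  @RComod k C C comul (@comulA k C) (@counitr k C).

Fact dual_mulA : associative dual_mul.
Proof.
move=> a b d; apply: dual_ext => c.
by congr (dual_eval a _); exact: (@contr_r_mul coalg_rcomod b d c).
Qed.
Fact dual_mul1 : left_id dual_one dual_mul.
Proof.
move=> a; apply: dual_ext => c.
change (counit (contr_r a (comul c)) = a c).
by rewrite contr_lr counitl.
Qed.
Fact dual_1mul : right_id dual_one dual_mul.
Proof. by move=> a; apply: dual_ext => c; congr (dual_eval a _); exact: counitr. Qed.
Fact dual_mulDl : left_distributive dual_mul +%R.
Proof. by move=> a b d; apply: dual_ext => c. Qed.
Fact dual_mulDr : right_distributive dual_mul +%R.
Proof.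
move=> a b d; apply: dual_ext => c.
change (a (contr_r (dual_add b d) (comul c)) =
        a (contr_r b (comul c)) + a (contr_r d (comul c))).
rewrite (@contr_r_lin _ _ _ 1 b d) ?linearP ?mul1r //.
by move=> c'; rewrite mul1r.
Qed.

HB.instance Definition _ := GRing.Zmodule_isPzRing.Build A
  dual_mulA dual_mul1 dual_1mul dual_mulDl dual_mulDr.

Fact dual_scaleAl x a b : x *: (a * b) = (x *: a) * b.
Proof. by apply: dual_ext. Qed.
Fact dual_scaleAr x a b : x *: (a * b) = a * (x *: b).
Proof.
apply: dual_ext => c.
change (x * a (contr_r b (comul c)) = a (contr_r (dual_scale x b) (comul c))).
have -> : contr_r (dual_scale x b) (comul c) = x *: contr_r b (comul c) by apply: contr_rZ.
by rewrite scalarZ.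
Qed.

End Dual.

Coercion dual_eval : dual >-> GRing.Linear.type.

Record bimod (k : fieldType) (C : coalgebra k) := Bimod {
  bimod_space :> lmodType k;
  lact : {bilinear (dual C) -> bimod_space -> bimod_space};
  ract : {bilinear bimod_space -> (dual C) -> bimod_space};
  lactM : forall a b x, lact (a * b) x = lact a (lact b x);
  lact1 : forall x, lact 1 x = x;
  ractM : forall a b x, ract x (a * b) = ract (ract x a) b;
  ract1 : forall x, ract x 1 = x;
  lractA : forall a b x, ract (lact a x) b = lact a (ract x b)
}.

Arguments lact {k C _}.
Arguments ract {k C _}.

Definition bimod_hom (k : fieldType) (C : coalgebra k) (B B' : bimod C)
    (f : {linear B -> B'}) : Prop :=
  forall a x, f (lact a x) = lact a (f x) /\ f (ract x a) = ract (f x) a.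

(* The action a . m = \sum m_0 a(m_1) on a right comodule. *)
Definition rcomod_act (k : fieldType) (C : coalgebra k) (M : rcomod C) (a : dual C) :
    {linear M -> M} :=
  contr_r a \o rcoact.

(* The action n . a = \sum a(n_{-1}) n_0 on a left comodule. *)
Definition lcomod_act (k : fieldType) (C : coalgebra k) (N : lcomod C) (a : dual C) :
    {linear N -> N} :=
  contr_l a \o lcoact.

Section TensorBimod.
Variables (k : fieldType) (C : coalgebra k) (M : rcomod C) (N : lcomod C).

Definition tensor_lact (a : dual C) (t : tensor M N) : tensor M N :=
  tmap (rcomod_act M a) idfun t.

Definition tensor_ract (t : tensor M N) (a : dual C) : tensor M N :=
  tmap idfun (lcomod_act N a) t.

Fact tensor_lact_bilinear : bilinear_for *:%R *:%R tensor_lact.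
Proof.
split=> [t|a] x y z; last exact: linearP.
apply: tmap_linl => m; exact: contr_r_lin.
Qed.

Fact tensor_ract_bilinear : bilinear_for *:%R *:%R tensor_ract.
Proof.
split=> [a|t] x y z; first exact: linearP.
apply: tmap_linr => n; exact: contr_l_lin.
Qed.

HB.instance Definition _ := bilinear_isBilinear.Build k (dual C) (tensor M N)
  (tensor M N) *:%R *:%R tensor_lact tensor_lact_bilinear.
HB.instance Definition _ := bilinear_isBilinear.Build k (tensor M N) (dual C)
  (tensor M N) *:%R *:%R tensor_ract tensor_ract_bilinear.

Fact tensor_lactM a b t : tensor_lact (a * b) t = tensor_lact a (tensor_lact b t).
Proof. by rewrite /tensor_lact tmap_comp; apply: eq_tmap => // m; apply: contr_r_mul. Qed.
Fact tensor_lact1 t : tensor_lact 1 t = t.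
Proof. by rewrite -[RHS]tmap_id; apply: eq_tmap => // m; apply: rcoact1. Qed.
Fact tensor_ractM a b t : tensor_ract t (a * b) = tensor_ract (tensor_ract t a) b.
Proof. by rewrite /tensor_ract tmap_comp; apply: eq_tmap => // n; apply: contr_l_mul. Qed.
Fact tensor_ract1 t : tensor_ract t 1 = t.
Proof. by rewrite -[RHS]tmap_id; apply: eq_tmap => // n; apply: lcoact1. Qed.
Fact tensor_lractA a b t :
  tensor_ract (tensor_lact a t) b = tensor_lact a (tensor_ract t b).
Proof. by rewrite /tensor_lact /tensor_ract !tmap_comp; apply: eq_tmap. Qed.

Definition tensor_bimod : bimod C := @Bimod k C (tensor M N) tensor_lact tensor_ract
  tensor_lactM tensor_lact1 tensor_ractM tensor_ract1 tensor_lractA.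

End TensorBimod.

Section Rational.
Variables (k : fieldType) (C : coalgebra k).

(* D is finite-dimensional, and Delta(D) is contained in D (x) D. *)
Definition fd_subcoalgebra (D : submodClosed C) : Prop :=
  (exists s : seq C, forall c, c \in D -> c \in span [set` s]) /\
  (forall c, c \in D ->
     exists t : tensor (subsp D) (subsp D), comul c = tmap incl incl t).

(* The ideal I_alpha of functions vanishing on [D]. *)
Definition vanishing (D : submodClosed C) (a : dual C) : Prop :=
  forall c, c \in D -> a c = 0.

(* Each b in B is annihilated on both sides by some I_alpha, i.e. the
   sub-bimodule A b A is a quotient of A_alpha (x) A_alpha^op. *)
Definition rational (B : bimod C) : Prop :=
  forall b : B, exists D : submodClosed C, fd_subcoalgebra D /\
    forall a, vanishing D a -> lact a b = 0 /\ ract b a = 0.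

End Rational.

Section Center.
Variables (k : fieldType) (C : coalgebra k).

Definition center_pred (B : bimod C) : {pred B} :=
  fun b => `[< forall a, lact a b = ract b a >].

Fact center_submod (B : bimod C) : submod_closed (@center_pred B).
Proof.
split=> [|x b b' /asboolP bE /asboolP bE']; apply/asboolP => a.
  by rewrite linear0r linear0l.
by rewrite linearPr linearPl bE bE'.
Qed.

HB.instance Definition _ (B : bimod C) :=
  GRing.isSubmodClosed.Build k B (@center_pred B) (@center_submod B).

(* Hom_{A^e}(A, B), as a subspace of B *)
Definition center (B : bimod C) : submodClosed B := @center_pred B.

Fact center_stable (B B' : bimod C) (f : {linear B -> B'}) : bimod_hom f ->
  forall b, b \in center B -> f b \in center B'.
Proof.
move=> fH b /asboolP bE; apply/asboolP => a.
by rewrite -(fH a b).1 -(fH a b).2 bE.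
Qed.

End Center.

Record cochain (k : fieldType) := Cochain {
  cterm :> nat -> lmodType k;
  cdiff : forall n, {linear cterm n -> cterm n.+1};
  cdiffK : forall n x, cdiff n.+1 (cdiff n x) = 0
}.

Section Cohomology.
Variables (k : fieldType) (X : cochain k).

Definition cocycles n : lmodType k := subsp (ker (cdiff X n)).

Definition coboundary n : X n -> Prop :=
  match n with
  | 0 => fun x => x = 0
  | m.+1 => fun x => exists y, x = cdiff X m y
  end.

Definition coboundary_pred n : {pred cocycles n} := fun z => `[< coboundary (incl z) >].

Fact coboundary_linear n a (x y : X n) :
  coboundary x -> coboundary y -> coboundary (a *: x + y).
Proof.
case: n x y => [|n] x y /=; first by move=> -> ->; rewrite scaler0 addr0.
by move=> [x' ->] [y' ->]; exists (a *: x' + y'); rewrite linearP.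
Qed.

Fact coboundary_submod n : submod_closed (@coboundary_pred n).
Proof.
split=> [|a z z' /asboolP zB /asboolP zB']; apply/asboolP.
  by rewrite linear0; case: n => [//|n]; exists 0; rewrite linear0.
by rewrite linearP; exact: coboundary_linear.
Qed.

HB.instance Definition _ n := GRing.isSubmodClosed.Build k (cocycles n)
  (@coboundary_pred n) (@coboundary_submod n).

Definition cohomology n : lmodType k := quotsp (@coboundary_pred n).

End Cohomology.

Record bicomplex (k : fieldType) := Bicomplex {
  bterm :> nat -> nat -> lmodType k;
  hdiff : forall p q, {linear bterm p q -> bterm p.+1 q};
  vdiff : forall p q, {linear bterm p q -> bterm p q.+1};
  hdiffK : forall p q x, hdiff p.+1 q (hdiff p q x) = 0;
  vdiffK : forall p q x, vdiff p q.+1 (vdiff p q x) = 0;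
  hvdiff : forall p q x, hdiff p q.+1 (vdiff p q x) = vdiff p.+1 q (hdiff p q x)
}.

Section Total.
Variables (k : fieldType) (X : bicomplex k).

(* The n-th term of the total complex, the direct sum of the X p q for
   p + q = n, is encoded by the families (x_(p,q)) supported on p + q = n. *)
Let P : lmodType k := dprod (fun i : nat * nat => X i.1 i.2).

Definition total_pred n : {pred P} :=
  fun x => `[< forall i, (i.1 + i.2)%N != n -> x i = 0 >].

Fact total_submod n : submod_closed (total_pred n).
Proof.
split=> [|a x y /asboolP xn /asboolP yn]; apply/asboolP => i ni //.
by rewrite -[LHS]/(a *: x i + y i) xn // yn // scaler0 addr0.
Qed.

HB.instance Definition _ n :=
  GRing.isSubmodClosed.Build k P (total_pred n) (total_submod n).

Definition hdiff_to p q : P -> X p q :=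
  match p with 0 => fun _ => 0 | p'.+1 => fun x => hdiff X p' q (x (p', q)) end.

Definition vdiff_to p q : P -> X p q :=
  match q with 0 => fun _ => 0 | q'.+1 => fun x => (-1) ^+ p *: vdiff X p q' (x (p, q')) end.

Definition total_diff_fun (x : P) : P := fun i => hdiff_to i.1 i.2 x + vdiff_to i.1 i.2 x.

Fact hdiff_to_linear p q a (x y : P) :
  hdiff_to p q (a *: x + y) = a *: hdiff_to p q x + hdiff_to p q y.
Proof.
case: p => [|p] /=; first by rewrite scaler0 addr0.
exact: (linearP (hdiff X p q)).
Qed.

Fact vdiff_to_linear p q a (x y : P) :
  vdiff_to p q (a *: x + y) = a *: vdiff_to p q x + vdiff_to p q y.
Proof.
case: q => [|q] /=; first by rewrite scaler0 addr0.
have -> : vdiff X p q ((a *: x + y) (p, q)) =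
    a *: vdiff X p q (x (p, q)) + vdiff X p q (y (p, q)) by exact: (linearP (vdiff X p q)).
by rewrite scalerDr !scalerA mulrC.
Qed.

Fact total_diff_linear : linear total_diff_fun.
Proof.
move=> a x y; apply: functional_extensionality_dep => i.
rewrite /total_diff_fun hdiff_to_linear vdiff_to_linear addrACA -scalerDr.
by [].
Qed.

HB.instance Definition _ :=
  GRing.isLinear.Build k P P *:%R total_diff_fun total_diff_linear.

Fact total_diff_stable n x :
  x \in total_pred n -> total_diff_fun x \in total_pred n.+1.
Proof.
move=> /asboolP xn; apply/asboolP => -[p q] /= pq; rewrite /total_diff_fun /=.
have -> : hdiff_to p q x = 0.
  by case: p pq => [//|p] pq /=; rewrite (xn (p, q)) ?linear0.
rewrite add0r; case: q pq => [//|q] pq /=.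
by rewrite (xn (p, q)) ?linear0 ?scaler0 //= -eqSS -addnS.
Qed.

Definition total_diff n :
    {linear subsp (total_pred n) -> subsp (total_pred n.+1)} :=
  submap (f := total_diff_fun) (@total_diff_stable n).

Fact total_diff_funK x : total_diff_fun (total_diff_fun x) = 0.
Proof.
have hh p q : hdiff X p q (hdiff_to p q x) = 0.
  by case: p => [|p] /=; rewrite (linear0, hdiffK).
have vv p q : vdiff X p q (vdiff_to p q x) = 0.
  by case: q => [|q] /=; rewrite ?linear0 // linearZ /= vdiffK scaler0.
apply: functional_extensionality_dep => -[p q].
rewrite -[RHS]/(0 : X p q) {1}/total_diff_fun /=.
case: p q => [|p] [|q] /=; rewrite ?addr0 ?add0r //.
- by rewrite /total_diff_fun /= add0r vv scaler0.
- by rewrite /total_diff_fun /= addr0 hh.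
rewrite {1 2}/total_diff_fun /= linearD hh add0r linearZ.
rewrite [X in _ + _ *: X]linearD vv addr0 hvdiff exprS mulN1r scaleNr.
exact: subrr.
Qed.

Fact total_diffK n x : total_diff n.+1 (total_diff n x) = 0.
Proof. by apply: incl_inj; rewrite linear0; exact: total_diff_funK. Qed.

Definition total : cochain k := Cochain total_diffK.

End Total.

(* A category of k-vector spaces with extra structure: its morphisms are the
   linear maps satisfying [hom]. In the categories of comodules and of rational
   bimodules, monomorphisms and exactness are those of the underlying vector
   spaces, hence the use of [injective] and of kernels and images of linear
   maps below. *)
Record lincat (k : fieldType) := LinCat {
  obj :> Type;
  fgt : obj -> lmodType k;
  hom : forall X Y : obj, {linear fgt X -> fgt Y} -> Prop;
  hom_id : forall X : obj, hom (idfun : {linear fgt X -> fgt X});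
  hom_comp : forall (X Y Z : obj) (f : {linear fgt X -> fgt Y})
    (g : {linear fgt Y -> fgt Z}), hom f -> hom g -> hom (g \o f)
}.

Section Resolution.
Variables (k : fieldType) (K : lincat k).

(* [E] is an injective object of the full subcategory of [K] defined by [P].
   ([K -> Prop] and not [set K], because of the size of [K].) *)
Definition injective_obj (P : K -> Prop) (E : K) : Prop :=
  P E /\
  forall (X Y : K) (i : {linear fgt X -> fgt Y}) (f : {linear fgt X -> fgt E}),
    P X -> P Y -> hom i -> injective i -> hom f ->
    exists2 g : {linear fgt Y -> fgt E}, hom g & forall x, g (i x) = f x.

(* 0 -> X -> E_0 -> E_1 -> ... with all E_n injective in the subcategory [P];
   if [P] is closed under subobjects, as [rational] is, then [P X] follows. *)
Record injres (P : K -> Prop) (X : K) := InjRes {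
  rterm :> nat -> K;
  raug : {linear fgt X -> fgt (rterm 0)};
  rdiff : forall n, {linear fgt (rterm n) -> fgt (rterm n.+1)};
  rterm_injective : forall n, injective_obj P (rterm n);
  raug_hom : hom raug;
  rdiff_hom : forall n, hom (rdiff n);
  raug_injective : injective raug;
  raug_exact : forall y, rdiff 0 y = 0 <-> exists x, y = raug x;
  rdiff_exact : forall n y, rdiff n.+1 y = 0 <-> exists x, y = rdiff n x
}.

Fact rdiffK (P : K -> Prop) X (E : injres P X) n x : rdiff E n.+1 (rdiff E n x) = 0.
Proof. by apply/rdiff_exact; exists x. Qed.

End Resolution.

Section Categories.
Variables (k : fieldType) (C : coalgebra k).

Fact rcomod_hom_id (M : rcomod C) : rcomod_hom (idfun : {linear M -> M}).
Proof. by move=> m; rewrite tmap_id. Qed.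

Fact rcomod_hom_comp (M1 M2 M3 : rcomod C) (f : {linear M1 -> M2})
    (g : {linear M2 -> M3}) :
  rcomod_hom f -> rcomod_hom g -> rcomod_hom (g \o f).
Proof.
move=> fH gH m; change (rcoact (g (f m)) = tmap (g \o f) idfun (rcoact m)).
by rewrite gH fH tmap_comp; apply: eq_tmap.
Qed.

Definition rcomod_cat : lincat k :=
  @LinCat k (rcomod C) (@rcomod_space k C) (@rcomod_hom k C)
    rcomod_hom_id rcomod_hom_comp.

Fact lcomod_hom_id (N : lcomod C) : lcomod_hom (idfun : {linear N -> N}).
Proof. by move=> n; rewrite tmap_id. Qed.

Fact lcomod_hom_comp (N1 N2 N3 : lcomod C) (f : {linear N1 -> N2})
    (g : {linear N2 -> N3}) :
  lcomod_hom f -> lcomod_hom g -> lcomod_hom (g \o f).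
Proof.
move=> fH gH n; change (lcoact (g (f n)) = tmap idfun (g \o f) (lcoact n)).
by rewrite gH fH tmap_comp; apply: eq_tmap.
Qed.

Definition lcomod_cat : lincat k :=
  @LinCat k (lcomod C) (@lcomod_space k C) (@lcomod_hom k C)
    lcomod_hom_id lcomod_hom_comp.

Fact bimod_hom_id (B : bimod C) : bimod_hom (idfun : {linear B -> B}).
Proof. by []. Qed.

Fact bimod_hom_comp (B1 B2 B3 : bimod C) (f : {linear B1 -> B2})
    (g : {linear B2 -> B3}) :
  bimod_hom f -> bimod_hom g -> bimod_hom (g \o f).
Proof.
move=> fH gH a x.
by split; [rewrite /= (fH a x).1 (gH a _).1|rewrite /= (fH a x).2 (gH a _).2].
Qed.

Definition bimod_cat : lincat k :=
  @LinCat k (bimod C) (@bimod_space k C) (@bimod_hom k C)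
    bimod_hom_id bimod_hom_comp.

End Categories.

Definition rcomod_injres (k : fieldType) (C : coalgebra k) (M : rcomod C) : Type :=
  @injres k (rcomod_cat C) (fun _ => True) M.

Definition lcomod_injres (k : fieldType) (C : coalgebra k) (N : lcomod C) : Type :=
  @injres k (lcomod_cat C) (fun _ => True) N.

Definition rational_injres (k : fieldType) (C : coalgebra k) (B : bimod C) : Type :=
  @injres k (bimod_cat C) (@rational k C) B.

Section Cotor.
Variables (k : fieldType) (C : coalgebra k) (M : rcomod C) (N : lcomod C).
Variables (E1 : rcomod_injres M) (E2 : lcomod_injres N).

Let T p q : lmodType k := cotensor (E1 p : rcomod C) (E2 q : lcomod C).

Definition cotensor_hdiff p q : {linear T p q -> T p.+1 q} :=
  cotensor_map (rdiff_hom E1 p : rcomod_hom _) (@lcomod_hom_id k C (E2 q)).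

Definition cotensor_vdiff p q : {linear T p q -> T p q.+1} :=
  cotensor_map (@rcomod_hom_id k C (E1 p)) (rdiff_hom E2 q : lcomod_hom _).

Fact cotensor_hdiffK p q x : cotensor_hdiff p.+1 q (cotensor_hdiff p q x) = 0.
Proof.
apply: incl_inj; rewrite linear0 !submapE tmap_comp tmap0l // => v.
exact: (@rdiffK k (rcomod_cat C)).
Qed.

Fact cotensor_vdiffK p q x : cotensor_vdiff p q.+1 (cotensor_vdiff p q x) = 0.
Proof.
apply: incl_inj; rewrite linear0 !submapE tmap_comp tmap0r // => v.
exact: (@rdiffK k (lcomod_cat C)).
Qed.

Fact cotensor_hvdiff p q x :
  cotensor_hdiff p q.+1 (cotensor_vdiff p q x) = cotensor_vdiff p.+1 q (cotensor_hdiff p q x).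
Proof. by apply: incl_inj; rewrite !submapE !tmap_comp; apply: eq_tmap. Qed.

Definition cotensor_bicomplex : bicomplex k :=
  Bicomplex cotensor_hdiffK cotensor_vdiffK cotensor_hvdiff.

Definition Cotor n : lmodType k := cohomology (total cotensor_bicomplex) n.

End Cotor.

Section ContinuousHochschild.
Variables (k : fieldType) (C : coalgebra k) (B : bimod C) (J : rational_injres B).

Definition center_diff n :
    {linear subsp (center (J n : bimod C)) -> subsp (center (J n.+1 : bimod C))} :=
  submap (center_stable (rdiff_hom J n : bimod_hom _)).

Fact center_diffK n x : center_diff n.+1 (center_diff n x) = 0.
Proof. by apply: incl_inj; rewrite linear0 !submapE; exact: (@rdiffK k (bimod_cat C)). Qed.

Definition center_complex : cochain k := Cochain center_diffK.

Definition Hctn n : lmodType k := cohomology center_complex n.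

End ContinuousHochschild.

(* Main.v *)
(* Let M -> E1 and N -> E2 be injective resolutions by comodules.  A rational
   action of the dual algebra A is the same as a coaction of C, and an injective
   comodule is a retract of a cofree one; averaging a linear extension over the
   two coactions therefore shows that each E1_p (x) E2_q is an injective rational
   bimodule.  Exact sequences of vector spaces are contractible, so the total
   complex of E1 (x) E2 is exact and is an injective resolution of M (x) N.  The
   center of E1_p (x) E2_q is the cotensor product, because functionals on C
   separate the elements of M (x) C (x) N.  Hence Cotor is computed by the centers
   of one particular injective resolution of M (x) N, and any two such
   resolutions have the same cohomology of centers. *)

From HB Require Import structures.
Require Import Defs.
From mathcomp Require Import all_boot all_algebra.
From mathcomp Require Import boolp classical_sets.

Set Implicit Arguments.
Unset Strict Implicit.
Unset Printing Implicit Defensive.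

Import Defs GRing.Theory.
Local Open Scope ring_scope.

(** * Linear algebra and tensor products over a field *)

(** [C] may be infinite-dimensional, so [B (x) C] cannot be treated as a space of maps from the dual
    of a finite-dimensional space. Its substitute is that contractions with functionals determine a
    tensor: a coaction is known through its action, and identities between coactions are tested on
    the actions. The existence of a coaction uses rationality, one element at a time. Averaging
    handles one coaction, while injectivity is two-sided. A linear extension is averaged for the
    left action and the result for the right one. The second averaging keeps left linearity because
    the two actions commute, and neither changes the values on the subobject, where the map is
    already equivariant. Injectivity is relative to rational bimodules. This forces each degree of
    the total complex to be a finite sum, and makes it matter that images inside rational bimodules
    are rational. Comparison maps and homotopies are built separately in each degree, each carrying
    only what it needs from the degree below. *)

Section LinearAlgebra.
Variable k : fieldType.
Implicit Types U V W : lmodType k.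

Definition linear_of U V (f : U -> V) (f_lin : linear f) : {linear U -> V} :=
  HB.pack_for {linear U -> V} f (GRing.isLinear.Build k U V *:%R f f_lin).

Definition bilinear_of U V W (f : U -> V -> W) (f_bilin : bilinear_for *:%R *:%R f) :
    {bilinear U -> V -> W} :=
  HB.pack_for {bilinear U -> V -> W} f
    (bilinear_isBilinear.Build k U V W *:%R *:%R f f_bilin).

Fact submod_of_closed V (P : V -> Prop) (P0 : P 0)
    (PD : forall a x y, P x -> P y -> P (a *: x + y)) :
  submod_closed (fun x => `[< P x >] : bool).
Proof.
split=> [|a x y /asboolP Px /asboolP Py]; first exact/asboolP.
exact/asboolP/PD.
Qed.

Definition submod_of V (P : V -> Prop) (P0 : P 0)
    (PD : forall a x y, P x -> P y -> P (a *: x + y)) : submodClosed V :=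
  HB.pack_for (submodClosed V) (fun x => `[< P x >] : bool)
    (GRing.isSubmodClosed.Build k V (fun x => `[< P x >] : bool)
      (submod_of_closed P0 PD)).

Lemma mem_submod_of V (P : V -> Prop) P0 PD x : x \in @submod_of V P P0 PD <-> P x.
Proof. by split=> [/asboolP|Px] //; apply/asboolP. Qed.

(** Zorn's lemma on the sets closed under [a *: x + y] that meet [S] at most in 0. The empty set is
    allowed, being the union of the empty chain; maximality then puts 0 in [A]. If [v] were not in
    [S + A], the sums of a multiple of [v] and an element of [A] would form a larger such set. *)
Lemma exists_complement V (S : submodClosed V) : exists W : submodClosed V,
  (forall x, x \in S -> x \in W -> x = 0) /\
  (forall v, exists s w, [/\ s \in S, w \in W & v = s + w]).
Proof.
pose P (A : set V) := (forall a x y, A x -> A y -> A (a *: x + y)) /\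
                      (forall x, A x -> x \in S -> x = 0).
have [F FP Ftot|A [[Alin AS] Amax]] := @Zorn_bigcup V P.
  split=> [a x y [X FX Xx] [Y FY Yy]|x [X FX Xx]]; last exact: (FP _ FX).2.
  have [XY|YX] := Ftot _ _ FX FY.
    by exists Y => //; apply: (FP _ FY).1 => //; apply: XY.
  by exists X => //; apply: (FP _ FX).1 => //; apply: YX.
have A0 : A 0.
  apply: contrapT => nA0; apply: (Amax (fun x => x = 0)).
    split=> [x Ax|/(_ 0 erefl)//]; case: nA0.
    by rewrite -(addNr x) -scaleN1r; apply: Alin.
  by split=> [a x y -> ->|x ->//]; rewrite scaler0 addr0.
have AZ a x : A x -> A (a *: x) by move=> Ax; rewrite -[_ *: _]addr0; apply: Alin.
exists (submod_of A0 Alin); split=> [x xS /mem_submod_of Ax|v]; first exact: AS.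
apply: contrapT => nv.
pose B : set V := fun x => exists c w, A w /\ x = c *: v + w.
apply: (Amax B); first split=> [x Ax|/(_ v) vA].
- by exists 0, x; rewrite scale0r add0r.
- case: nv; exists 0, v; split; rewrite ?rpred0 ?add0r //; apply/mem_submod_of/vA.
  by exists 1, 0; rewrite scale1r addr0.
split=> [a _ _ [c [w [Aw ->]]] [c' [w' [Aw' ->]]]|_ [c [w [Aw ->]]] cS].
  exists (a * c + c'), (a *: w + w'); split; first exact: (Alin _ _ _ Aw Aw').
  by rewrite scalerDr scalerA addrACA scalerDl.
have [c0|c_neq0] := eqVneq c 0.
  by move: cS; rewrite c0 scale0r add0r; apply: AS.
case: nv; exists (c^-1 *: (c *: v + w)), (- c^-1 *: w); split; first exact: rpredZ.
  exact/mem_submod_of/AZ.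
by rewrite scalerDr scalerA mulVf // scale1r scaleNr addrK.
Qed.

Fact image0 U V (f : {linear U -> V}) : exists u, (0 : V) = f u.
Proof. by exists 0; rewrite linear0. Qed.

Fact imageD U V (f : {linear U -> V}) a x y :
  (exists u, x = f u) -> (exists u, y = f u) -> exists u, a *: x + y = f u.
Proof. by move=> [u ->] [v ->]; exists (a *: u + v); rewrite linearP. Qed.

Definition lin_image U V (f : {linear U -> V}) : submodClosed V :=
  submod_of (image0 f) (@imageD U V f).

Lemma lin_imageP U V (f : {linear U -> V}) x : x \in lin_image f <-> exists u, x = f u.
Proof. exact: mem_submod_of. Qed.

(** With complements [K] of the kernel and [W] of the image, [g v] is the only [u] in [K] with
    [v - f u] in [W]. This one form yields retractions of injections, sections of quotient maps and
    contractions of exact sequences. *)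
Lemma generalized_inverse U V (f : {linear U -> V}) :
  exists g : {linear V -> U}, forall x, f (g (f x)) = f x.
Proof.
have [K [Kker Ksum]] := exists_complement (ker f).
have [W [Wim Wsum]] := exists_complement (lin_image f).
have exg v : exists u, u \in K /\ v - f u \in W.
  have [_ [w [/lin_imageP[u ->] wW ->]]] := Wsum v.
  have [u0 [u1 [/kerP fu0 u1K ->]]] := Ksum u.
  by exists u1; rewrite linearD fu0 add0r addrAC subrr add0r.
have /choice[g gP] := exg.
have uniq v u : u \in K -> v - f u \in W -> g v = u.
  move=> uK uW; apply/eqP; rewrite -subr_eq0; apply/eqP/Kker; last first.
    by rewrite -scaleN1r rpredD ?rpredZ ?(gP v).1.
  apply/kerP/Wim; first by apply/lin_imageP; exists (g v - u).
  have -> : f (g v - u) = (v - f u) + (-1) *: (v - f (g v)).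
    by rewrite linearB scaleN1r opprB [RHS]addrC addrA subrK.
  by rewrite rpredD ?rpredZ ?(gP v).2.
have g_lin : linear g.
  move=> a x y; apply: uniq; first by rewrite rpredD ?rpredZ ?(gP _).1.
  have -> : a *: x + y - f (a *: g x + g y) = a *: (x - f (g x)) + (y - f (g y)).
    by rewrite linearP scalerBr opprD addrACA.
  by rewrite rpredD ?rpredZ ?(gP _).2.
exists (linear_of g_lin) => x /=; apply/eqP; rewrite eq_sym -subr_eq0; apply/eqP.
apply: Wim (gP (f x)).2; apply/lin_imageP; exists (x - g (f x)).
by rewrite linearB.
Qed.

Lemma linear_retraction U V (f : {linear U -> V}) : injective f ->
  exists g : {linear V -> U}, cancel f g.
Proof.
by move=> f_inj; have [g gP] := generalized_inverse f; exists g => x; apply: f_inj.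
Qed.

(** The line through the class of [x] embeds into the quotient by [S]; a linear retraction of that
    embedding is the functional. *)
Lemma separating_functional V (S : submodClosed V) x : x \notin S ->
  exists2 f : {scalar V}, forall y, y \in S -> f y = 0 & f x = 1.
Proof.
move=> xS; pose q := qproj S.
have h_lin : linear (fun c : k^o => c *: q x).
  by move=> a b c; rewrite scalerDl scalerA.
have [|g gK] := @linear_retraction _ _ (linear_of h_lin).
  move=> a b /eqP; rewrite -subr_eq0 -scalerBl scaler_eq0 subr_eq0 => /orP[/eqP//|/eqP].
  rewrite -(linear0 q) => /qproj_eq; rewrite subr0 => xS'.
  by rewrite xS' in xS.
exists (g \o q) => [y yS|].
  have qy0 : q y = 0 by rewrite -(linear0 q); apply/qproj_eq; rewrite subr0.
  by rewrite -[LHS]/(g (q y)) qy0 linear0.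
by rewrite -[LHS]/(g (q x)) -[q x]scale1r; apply: gK.
Qed.

Lemma scalar_separation V (x : V) : (forall f : {scalar V}, f x = 0) -> x = 0.
Proof.
move=> fx; apply: contrapT => /eqP x0.
pose Z : submodClosed V := ker (idfun : {linear V -> V}).
have [|f _ /eqP] := @separating_functional V Z x; last by rewrite fx eq_sym oner_eq0.
by apply: contra x0 => /kerP/eqP.
Qed.

Lemma mem_span V (P : set V) x : P x -> x \in span P.
Proof. by move=> Px; apply/asboolP => S; apply. Qed.

Lemma span_ind V (P Q : V -> Prop) : Q 0 ->
  (forall a x y, Q x -> Q y -> Q (a *: x + y)) ->
  (forall x, P x -> Q x) -> forall x, x \in span P -> Q x.
Proof.
move=> Q0 QD PQ x /asboolP/(_ (submod_of Q0 QD)) xQ.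
by apply/mem_submod_of/xQ => y /PQ ?; apply/mem_submod_of.
Qed.

(** [Q] defines a subspace, and the projection to the quotient by it vanishes on pure tensors, hence
    everywhere. *)
Lemma tensor_ind V W (Q : tensor V W -> Prop) : Q 0 ->
  (forall a x y, Q x -> Q y -> Q (a *: x + y)) ->
  (forall v w, Q (tens v w)) -> forall t, Q t.
Proof.
move=> Q0 QD Qt t; apply/(mem_submod_of Q0 QD).
have : qproj (submod_of Q0 QD) t = 0.
  apply: (tens_eq (g := \0)) => v w; apply: etrans (linear0 (qproj _)).
  by apply/qproj_eq; rewrite subr0; apply/mem_submod_of.
by rewrite -(linear0 (qproj _)) => /qproj_eq; rewrite subr0.
Qed.

Lemma tensor_sum V W (t : tensor V W) :
  exists s : seq (V * W), t = \sum_(x <- s) tens x.1 x.2.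
Proof.
elim/tensor_ind: t => [|a _ _ [s ->] [s' ->]|v w].
- by exists [::]; rewrite big_nil.
- exists ([seq (a *: x.1, x.2) | x <- s] ++ s'); rewrite big_cat big_map scaler_sumr.
  by congr (_ + _); apply: eq_bigr => x _; rewrite linearZl_LR.
by exists [:: (v, w)]; rewrite big_seq1.
Qed.

End LinearAlgebra.

(** * Functionals separate tensors *)

Section Separation.
Variable k : fieldType.
Implicit Types U V W : lmodType k.
Local Open Scope classical_set_scope.

Lemma span_cons W (w : W) s x : x \in span [set` w :: s] ->
  exists a x', x' \in span [set` s] /\ x = a *: w + x'.
Proof.
elim/span_ind => {x} [|a _ _ [b [x [xs ->]]] [c [y [ys ->]]]|x].
- by exists 0, 0; rewrite rpred0 scale0r addr0.
- exists (a * b + c), (a *: x + y); split; first by rewrite rpredD ?rpredZ.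
  by rewrite scalerDr scalerA addrACA scalerDl.
rewrite /= inE => /orP[/eqP->|xs]; first by exists 1, 0; rewrite rpred0 scale1r addr0.
by exists 0, x; rewrite scale0r add0r; split=> //; apply: mem_span.
Qed.

Lemma span_nil W (x : W) : x \in span [set` ([::] : seq W)] -> x = 0.
Proof.
by elim/span_ind => {x} // a x y -> ->; rewrite scaler0 addr0.
Qed.

Lemma dual_functional W (w : W) (s : seq W) : w \notin span [set` s] ->
  exists g : {scalar W}, (forall x, x \in s -> g x = 0) /\ g w = 1.
Proof.
by move=> /separating_functional[g gs gw]; exists g; split=> // x xs; apply/gs/mem_span.
Qed.

Lemma tensor_sum_absorb V W (s : seq (V * W)) v w :
  w \in span [set` [seq x.2 | x <- s]] ->
  exists s', size s' = size s /\
    tens v w + \sum_(x <- s) tens x.1 x.2 = \sum_(x <- s') tens x.1 x.2.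
Proof.
elim: s w => [|[v1 w1] s IHs] w /=.
  by move/span_nil => ->; exists [::]; rewrite big_nil linear0r addr0.
case/span_cons=> a [w' [/IHs[s' [ss' s'E]] ->]].
exists ((v1 + a *: v, w1) :: s'); split; first by rewrite /= ss'.
rewrite !big_cons -s'E /= linearPr addrACA; congr (_ + _).
by rewrite addrC linearDl linearZl_LR.
Qed.

(* Induction on the length of a decomposition of [t]: its first right factor is
   either combined into the others, or detected by a functional killing them. *)
Lemma tensor_separation_r V W (t : tensor V W) :
  (forall g : {scalar W}, contr_r g t = 0) -> t = 0.
Proof.
have [s ->] := tensor_sum t; move: {2}(size s) (erefl (size s)) => n.
elim: n s => [|n IHn] [|[v w] s] //= => [_ _|[sn] t0]; first by rewrite big_nil.
have [ws|/dual_functional[g [gs gw]]] := boolP (w \in span [set` [seq x.2 | x <- s]]).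
  have [s' [ss' s'E]] := tensor_sum_absorb v ws; rewrite big_cons s'E.
  by apply: IHn => [|g]; rewrite ?ss' // -s'E; have := t0 g; rewrite big_cons.
have v0 : v = 0.
  have := t0 g; rewrite big_cons linearD contr_rE gw scale1r linear_sum.
  rewrite big_seq big1 ?addr0 // => x xs.
  by rewrite contr_rE gs ?scale0r //; apply: map_f.
rewrite big_cons v0 linear0l add0r; apply: IHn => // h.
by have := t0 h; rewrite big_cons v0 linear0l add0r.
Qed.

Lemma tensor_separation_l V W (t : tensor V W) :
  (forall f : {scalar V}, contr_l f t = 0) -> t = 0.
Proof.
move=> t0; apply: tensor_separation_r => g; apply: scalar_separation => f.
by rewrite contr_lr t0 linear0.
Qed.

Lemma eq_tensor_r V W (t u : tensor V W) :
  (forall g : {scalar W}, contr_r g t = contr_r g u) -> t = u.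
Proof.
move=> tu; apply/eqP; rewrite -subr_eq0; apply/eqP/tensor_separation_r => g.
by rewrite linearB tu subrr.
Qed.

Lemma eq_tensor_l V W (t u : tensor V W) :
  (forall f : {scalar V}, contr_l f t = contr_l f u) -> t = u.
Proof.
move=> tu; apply/eqP; rewrite -subr_eq0; apply/eqP/tensor_separation_l => g.
by rewrite linearB tu subrr.
Qed.

Lemma tassoc_inj U V W : injective (@tassoc k U V W).
Proof.
move=> t u tu; apply: eq_tensor_r => b; apply: eq_tensor_r => a.
by rewrite -!contr_r_tassoc tu.
Qed.

(** For [V = C] the functionals [a] are the elements of the dual algebra; this reduces the cotensor
    equation in [M (x) C (x) N] to an equation between actions. *)
Lemma tensor_separation_middle U V W (t u : tensor U (tensor V W)) :
  (forall a : {scalar V}, tmap idfun (contr_l a) t = tmap idfun (contr_l a) u) -> t = u.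
Proof.
move=> tu; apply: eq_tensor_l => f; apply: eq_tensor_l => a.
have H z : contr_l a (contr_l f z) =
    contr_l f (tmap (idfun : {linear U -> U}) (contr_l a) z).
  by rewrite contr_l_tmap.
by rewrite !H tu.
Qed.

(** A tensor involves finitely many right factors. For a coaction this is the rationality of the
    action it defines. *)
Lemma contr_finite_r V W (t : tensor V W) : exists s : seq W,
  forall g : {scalar W}, {in s, forall x, g x = 0} -> contr_r g t = 0.
Proof.
elim/tensor_ind: t => [|a t u [s st] [s' su]|v w].
- by exists [::] => g _; rewrite linear0.
- exists (s ++ s') => g g0; rewrite linearP st ?su ?scaler0 ?addr0 // => x xs.
    by apply: g0; rewrite mem_cat xs orbT.
  by apply: g0; rewrite mem_cat xs.
by exists [:: w] => g g0; rewrite contr_rE g0 ?scale0r // inE.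
Qed.

Lemma contr_finite_l V W (t : tensor V W) : exists s : seq V,
  forall g : {scalar V}, {in s, forall x, g x = 0} -> contr_l g t = 0.
Proof.
elim/tensor_ind: t => [|a t u [s st] [s' su]|v w].
- by exists [::] => g _; rewrite linear0.
- exists (s ++ s') => g g0; rewrite linearP st ?su ?scaler0 ?addr0 // => x xs.
    by apply: g0; rewrite mem_cat xs orbT.
  by apply: g0; rewrite mem_cat xs.
by exists [:: v] => g g0; rewrite contr_lE g0 ?scale0r // inE.
Qed.

End Separation.

(** * Rational actions are coactions *)

Section Rationality.
Variable k : fieldType.
Implicit Types U V W : lmodType k.
Local Open Scope classical_set_scope.

(** The hypotheses place [t] in both [S (x) W] and [V (x) T], so linear retractions onto [S] and [T]
    do not change it. *)
Lemma tensor_subsp V W (S : submodClosed V) (T : submodClosed W) (t : tensor V W) :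
  (forall g : {scalar W}, contr_r g t \in S) ->
  (forall f : {scalar V}, contr_l f t \in T) ->
  exists u : tensor (subsp S) (subsp T), t = tmap incl incl u.
Proof.
have [p pK] := linear_retraction (@incl_inj k V S).
have [q qK] := linear_retraction (@incl_inj k W T).
have pE x : x \in S -> incl (p x) = x by move=> xS; rewrite -(subsp_ofK xS) pK.
have qE x : x \in T -> incl (q x) = x by move=> xT; rewrite -(subsp_ofK xT) qK.
move=> tS tT; exists (tmap p q t); apply: eq_tensor_r => g.
rewrite !contr_r_tmap pE //; apply/eqP; rewrite -subr_eq0; apply/eqP.
apply: scalar_separation => f; rewrite linearB !contr_lr /=.
by rewrite -[X in _ - X]/(g (incl (q (contr_l f t)))) qE ?subrr.
Qed.

Lemma span_mono V (P Q : set V) x : P `<=` Q -> x \in span P -> x \in span Q.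
Proof.
move=> PQ; elim/span_ind => {x} [|a x y xQ yQ|x /PQ]; first exact: rpred0.
  by rewrite rpredD ?rpredZ.
exact: mem_span.
Qed.

Lemma contr_span_r V W (t : tensor V W) : exists s : seq V,
  forall g : {scalar W}, contr_r g t \in span [set` s].
Proof.
elim/tensor_ind: t => [|a t u [s st] [s' su]|v w].
- by exists [::] => g; rewrite linear0 rpred0.
- exists (s ++ s') => g; rewrite linearP rpredD ?rpredZ //.
    by apply: span_mono (st g) => x /= xs; rewrite mem_cat xs.
  by apply: span_mono (su g) => x /= xs; rewrite mem_cat xs orbT.
exists [:: v] => g; rewrite contr_rE rpredZ //; apply: mem_span.
by rewrite /= inE.
Qed.

Lemma contr_span_l V W (t : tensor V W) : exists s : seq W,
  forall g : {scalar V}, contr_l g t \in span [set` s].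
Proof.
elim/tensor_ind: t => [|a t u [s st] [s' su]|v w].
- by exists [::] => g; rewrite linear0 rpred0.
- exists (s ++ s') => g; rewrite linearP rpredD ?rpredZ //.
    by apply: span_mono (st g) => x /= xs; rewrite mem_cat xs.
  by apply: span_mono (su g) => x /= xs; rewrite mem_cat xs orbT.
exists [:: w] => g; rewrite contr_lE rpredZ //; apply: mem_span.
by rewrite /= inE.
Qed.

Variable C : coalgebra k.
Implicit Types (a b : dual C) (c : C).

Definition coalg_lcomod : lcomod C :=
  @LComod k C C comul (@comulA k C) (@counitl k C).

(** Coassociativity read on actions: the left and right actions of the dual algebra on [C]
    commute. *)
Lemma contr_comul_comm (f g : dual C) c :
  contr_r g (comul (contr_l f (comul c))) = contr_l f (comul (contr_r g (comul c))).
Proof.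
apply/eqP; rewrite -subr_eq0; apply/eqP; apply: scalar_separation => h.
rewrite linearB -[X in X - _]/(dual_mul h g (contr_l f (comul c))).
by rewrite -!contr_lr (@contr_r_mul k C (coalg_rcomod C) h g) subrr.
Qed.

Lemma fd_subcoalgebra_containing (s : seq C) :
  exists D : submodClosed C, fd_subcoalgebra D /\ {in s, forall c, c \in D}.
Proof.
(* D is the sub-bimodule generated by s under the two actions of the dual of C *)
pose P : set C := fun x => exists c a b, c \in s /\
  x = contr_l a (comul (contr_r b (comul c))).
exists (span P); split; first split.
(* Finite dimension: for all [b], [contr_r b (comul c)] lies in the span of the finite list [G c],
   and the left contractions of [comul x] lie in the span of [F x]. *)
- have /choice[F FP] x := contr_span_l (@comul k C x).
  have /choice[G GP] x := contr_span_r (@comul k C x).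
  exists (flatten [seq flatten [seq F x | x <- G c] | c <- s]) => x.
  elim/span_ind => {x} [|a x y xs ys|_ [c [a [b [cs ->]]]]]; first exact: rpred0.
    by rewrite rpredD ?rpredZ.
  apply: (@span_mono _ [set` flatten [seq F x | x <- G c]]).
    move=> x xG; apply/flattenP; exists (flatten [seq F x | x <- G c]) => //.
  exact: (map_f (fun c => flatten [seq F x | x <- G c])).
  elim/span_ind: (contr_r b _) / (GP c b) => [|e x y xs ys|x xG].
  + by rewrite !linear0 rpred0.
  + by rewrite !linearP rpredD ?rpredZ.
  apply: span_mono (FP x a) => y yF.
  by apply/flattenP; exists (F x) => //; apply: map_f.
(* A further contraction on either side is absorbed: the actions commute and compose, so [b] becomes
   [dual_mul g b], or [a] becomes [dual_mul a f]. *)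
- move=> c cP; apply: tensor_subsp => [g|f].
    elim/span_ind: c / cP => [|e x y xs ys|_ [c [a [b [cs ->]]]]].
    + by rewrite !linear0 rpred0.
    + by rewrite !linearP rpredD ?rpredZ.
    rewrite contr_comul_comm -(@contr_r_mul k C (coalg_rcomod C) g b).
    by apply: mem_span; exists c, a, (dual_mul g b).
  elim/span_ind: c / cP => [|e x y xs ys|_ [c [a [b [cs ->]]]]].
  + by rewrite !linear0 rpred0.
  + by rewrite !linearP rpredD ?rpredZ.
  rewrite -(@contr_l_mul k C coalg_lcomod a f).
  by apply: mem_span; exists c, (dual_mul a f), b.
move=> c cs; apply: mem_span; exists c, (dual_one C), (dual_one C).
by rewrite counitr counitl.
Qed.

(** A finite list replaces the subcoalgebra, so that conditions on several elements combine by
    concatenation. The converse is the fundamental theorem of coalgebras: a finite set lies in a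
    finite-dimensional subcoalgebra. *)
Lemma rational_seqP (B : bimod C) : rational B <-> forall b : B, exists s : seq C,
  forall a, {in s, forall c, a c = 0} -> lact a b = 0 /\ ract b a = 0.
Proof.
split=> ratB b.
  have [D [[[s sD] _] Db]] := ratB b; exists s => a a0; apply: Db => c /sD.
  elim/span_ind => {c} [|x c d ac ad|c /a0//]; first exact: linear0.
  by rewrite linearP ac ad addr0; apply: mulr0.
have [s sb] := ratB b; have [D [fdD sD]] := fd_subcoalgebra_containing s.
by exists D; split=> // a aD; apply: sb => c /sD; apply: aD.
Qed.

Lemma rational_sum (B : bimod C) (b b' : B) (x : k) :
  (exists s : seq C,
     forall a, {in s, forall c, a c = 0} -> lact a b = 0 /\ ract b a = 0) ->
  (exists s : seq C,
     forall a, {in s, forall c, a c = 0} -> lact a b' = 0 /\ ract b' a = 0) ->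
  exists s : seq C,
    forall a, {in s, forall c, a c = 0} ->
      lact a (x *: b + b') = 0 /\ ract (x *: b + b') a = 0.
Proof.
move=> [s sb] [s' sb']; exists (s ++ s') => a a0.
have [|lb rb] := sb a; first by move=> c cs; apply: a0; rewrite mem_cat cs.
have [|lb' rb'] := sb' a; first by move=> c cs; apply: a0; rewrite mem_cat cs orbT.
by rewrite linearPr linearPl lb rb lb' rb' scaler0 addr0.
Qed.

Lemma tensor_bimod_rational (M : rcomod C) (N : lcomod C) :
  rational (tensor_bimod M N).
Proof.
apply/rational_seqP => t; elim/tensor_ind: t => [|x t u|m n].
- by exists [::] => a _; rewrite linear0r linear0l.
- exact: (@rational_sum (tensor_bimod M N)).
have [s sm] := contr_finite_r (rcoact m); have [s' sn] := contr_finite_l (lcoact n).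
exists (s ++ s') => a a0; split.
  rewrite -[LHS]/(tmap _ _ (tens m n)) tmapE /= sm ?linear0l // => c cs.
  by apply: a0; rewrite mem_cat cs.
rewrite -[LHS]/(tmap _ _ (tens m n)) tmapE /= sn ?linear0r // => c cs.
by apply: a0; rewrite mem_cat cs orbT.
Qed.

(* Induction on [s]: if [g] is 1 at [c] and 0 on the other points, removing
   [F g (x) c] from the tensor makes [F] independent of the value at [c]. *)
Lemma finite_functional (Y : lmodType k) (F : dual C -> Y) (s : seq C) : linear F ->
  (forall a, {in s, forall c, a c = 0} -> F a = 0) ->
  exists t : tensor Y C, forall a, contr_r a t = F a.
Proof.
elim: s F => [|c s IHs] F Flin F0.
  by exists 0 => a; rewrite linear0 F0.
have [cs|/dual_functional[g [gs gc]]] := boolP (c \in span [set` s]).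
  apply: IHs => // a a0; apply: F0 => d; rewrite inE => /orP[/eqP->|/a0//].
  elim/span_ind: c / cs => [|x y z ay az|y /a0//]; first exact: linear0.
  by rewrite linearP ay az addr0; apply: mulr0.
have F'lin : linear (fun a => F a - a c *: F g).
  move=> x a b; rewrite Flin -[(x *: a + b : dual C) c]/(x * a c + b c).
  by rewrite scalerBr scalerDl scalerA opprD addrACA.
have [|t tE] := IHs _ F'lin.
  move=> a a0; pose a' : dual C := (- a c) *: (g : dual C) + a.
  have <- : F a' = F a - a c *: F g by rewrite Flin scaleNr addrC.
  apply: F0 => d; rewrite -[a' d]/(- a c * g d + a d) inE => /orP[/eqP->|ds].
    by rewrite gc mulr1 addNr.
  by rewrite (gs d ds) (a0 d ds) mulr0 addr0.
exists (t + tens (F g) c) => a.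
by rewrite linearD tE contr_rE subrK.
Qed.

(** The tensors [rho y] are chosen one by one; they depend linearly on [y] because their
    contractions do and determine them. *)
Lemma exists_coaction (Y : lmodType k) (act : dual C -> Y -> Y) :
  (forall y, linear (act^~ y)) -> (forall a, linear (act a)) ->
  (forall y, exists s : seq C,
     forall a, {in s, forall c, a c = 0} -> act a y = 0) ->
  exists rho : {linear Y -> tensor Y C}, forall a y, contr_r a (rho y) = act a y.
Proof.
move=> act_linl act_linr act_fin.
have /choice[rho rhoE] y : exists t : tensor Y C, forall a, contr_r a t = act a y.
  by have [s sP] := act_fin y; apply: finite_functional sP.
have rho_lin : linear rho.
  move=> x y z; apply: eq_tensor_r => g; rewrite linearP.
  by rewrite [LHS]rhoE !(rhoE _ g) act_linr.
by exists (linear_of rho_lin).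
Qed.

End Rationality.

(** * Injectivity of tensor products of injective comodules *)

Section Cofree.
Variables (k : fieldType) (C : coalgebra k).
Implicit Types V W : lmodType k.

Fact tensl_linear V W (v : V) : linear (@tens k V W v).
Proof. by move=> a x y; rewrite linearPr. Qed.
Definition tensl V W (v : V) : {linear W -> tensor V W} :=
  linear_of (@tensl_linear V W v).

Fact tensr_linear V W (w : W) : linear ((@tens k V W)^~ w).
Proof. by move=> a x y; rewrite linearPl. Qed.
Definition tensr V W (w : W) : {linear V -> tensor V W} :=
  linear_of (@tensr_linear V W w).

Section Right.
Variable V : lmodType k.

(** The coaction [1 (x) comul] of the cofree comodule, bracketed as [(V (x) C) (x) C]. Since
    [tassoc] leads out of this space, the map is given on pure tensors and identified by
    [tassoc_rcofree]. *)
Definition rcofree_fun (v : V) (c : C) : tensor (tensor V C) C :=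
  tmap (tensl C v) idfun (comul c).

Fact rcofree_bilinear : bilinear_for *:%R *:%R rcofree_fun.
Proof.
split=> [c|v] a x y; last by rewrite /rcofree_fun !linearP.
by apply: tmap_linl => z; apply: linearPl.
Qed.

Definition rcofree_coact : {linear tensor V C -> tensor (tensor V C) C} :=
  tlift (bilinear_of rcofree_bilinear).

Lemma rcofree_coactE v c :
  rcofree_coact (tens v c) = tmap (tensl C v) idfun (comul c).
Proof. by rewrite [LHS]tliftE. Qed.

Lemma tassoc_rcofree t : tassoc (rcofree_coact t) = tmap idfun comul t.
Proof.
apply: (tens_eq (f := tassoc \o rcofree_coact)) => v c.
rewrite -[LHS]/(tassoc (rcofree_coact (tens v c))) rcofree_coactE tmapE.
apply: (tens_eq (f := tassoc \o tmap (tensl C v) idfun) (g := tensl _ v)) => x y.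
by rewrite -[LHS]/(tassoc (tmap _ _ (tens x y))) tmapE tassocE.
Qed.

Fact rcofreeA t : tassoc (tmap rcofree_coact idfun (rcofree_coact t)) =
  tmap idfun comul (rcofree_coact t).
Proof.
apply: (tens_eq (f := tassoc \o tmap rcofree_coact idfun \o rcofree_coact)
  (g := tmap idfun comul \o rcofree_coact)) => v c.
rewrite -[LHS]/(tassoc (tmap rcofree_coact idfun (rcofree_coact (tens v c)))).
rewrite -[RHS]/(tmap idfun comul (rcofree_coact (tens v c))) rcofree_coactE !tmap_comp.
have -> : tmap (rcofree_coact \o tensl C v) (idfun \o idfun) (comul c) =
    tmap (tmap (tensl C v) idfun) idfun (tmap comul idfun (comul c)).
  by rewrite tmap_comp; apply: eq_tmap => // d; apply: rcofree_coactE.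
rewrite tassoc_nat comulA tmap_comp; apply: eq_tmap => // d /=.
exact: tmap_id.
Qed.

Fact rcofree1 t : contr_r counit (rcofree_coact t) = t.
Proof.
apply: (tens_eq (f := contr_r counit \o rcofree_coact) (g := idfun)) => v c.
rewrite -[LHS]/(contr_r counit (rcofree_coact (tens v c))) rcofree_coactE.
rewrite contr_r_tmap -[RHS]/(tens v c).
by have -> : contr_r (counit \o idfun) (comul c) = c by exact: counitr.
Qed.

Definition rcofree : rcomod C := RComod rcofreeA rcofree1.

End Right.

Lemma rcoact_hom (M : rcomod C) : @rcomod_hom k C M (rcofree M) rcoact.
Proof.
move=> m; apply: tassoc_inj.
by rewrite -[LHS]/(tassoc (rcofree_coact M (rcoact m))) tassoc_rcofree rcoactA.
Qed.

(** The coaction embeds [E] into the cofree comodule, the counit giving injectivity, so the identity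
    of [E] extends to [p]. Its colinearity is stated on pure tensors through the action, the form
    used for averaging. *)
Lemma injective_rcomod_retraction (E : rcomod C) :
  @injective_obj k (rcomod_cat C) (fun _ => True) E ->
  exists p : {linear tensor E C -> E},
    (forall a e c, rcomod_act E a (p (tens e c)) = p (tens e (contr_r a (comul c)))) /\
    (forall e, p (rcoact e) = e).
Proof.
move=> [_ /(_ E (rcofree E) rcoact idfun I I)].
move=> /(_ (@rcoact_hom E)) [||p pH pK].
- by move=> x y xy; rewrite -[x]rcoact1 xy rcoact1.
- exact: (@rcomod_hom_id k C E).
exists p; split=> // a e c; rewrite -[LHS]/(contr_r a (rcoact (p (tens e c)))).
rewrite pH contr_r_tmap; congr (p _).
rewrite -[LHS]/(contr_r (a \o idfun) (rcofree_coact E (tens e c))) rcofree_coactE.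
rewrite contr_r_tmap; congr (tens e _).
Qed.

Section Left.
Variable V : lmodType k.

Definition lcofree_fun (c : C) (v : V) : tensor C (tensor C V) :=
  tmap idfun (tensr C v) (comul c).

Fact lcofree_bilinear : bilinear_for *:%R *:%R lcofree_fun.
Proof.
split=> [v|c] a x y; first by rewrite /lcofree_fun !linearP.
by apply: tmap_linr => z; apply: linearPr.
Qed.

Definition lcofree_coact : {linear tensor C V -> tensor C (tensor C V)} :=
  tlift (bilinear_of lcofree_bilinear).

Lemma lcofree_coactE c v :
  lcofree_coact (tens c v) = tmap idfun (tensr C v) (comul c).
Proof. by rewrite [LHS]tliftE. Qed.

Lemma lcofree_tassoc t : lcofree_coact t = tassoc (tmap comul idfun t).
Proof.
apply: (tens_eq (g := tassoc \o tmap comul idfun)) => c v.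
rewrite -[RHS]/(tassoc (tmap _ _ (tens c v))) lcofree_coactE tmapE.
apply: (tens_eq (f := tmap idfun (tensr C v))
  (g := tassoc \o tensr (tensor C C) v)) => x y.
by rewrite -[RHS]/(tassoc (tens (tens x y) v)) tmapE tassocE.
Qed.

Fact lcofreeA t : tassoc (tmap comul idfun (lcofree_coact t)) =
  tmap idfun lcofree_coact (lcofree_coact t).
Proof.
apply: (tens_eq (f := tassoc \o tmap comul idfun \o lcofree_coact)
  (g := tmap idfun lcofree_coact \o lcofree_coact)) => c v.
rewrite -[LHS]/(tassoc (tmap comul idfun (lcofree_coact (tens c v)))).
rewrite -[RHS]/(tmap idfun lcofree_coact (lcofree_coact (tens c v))).
rewrite lcofree_coactE !tmap_comp.
have -> : tmap (comul \o idfun) (idfun \o tensr C v) (comul c) =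
    tmap (tmap idfun idfun) (tensr C v) (tmap comul idfun (comul c)).
  by rewrite tmap_comp; apply: eq_tmap => // d; rewrite /= tmap_id.
rewrite tassoc_nat comulA tmap_comp; apply: eq_tmap => // d.
by rewrite -[RHS]/(lcofree_coact (tens d v)) lcofree_coactE.
Qed.

Fact lcofree1 t : contr_l counit (lcofree_coact t) = t.
Proof.
apply: (tens_eq (f := contr_l counit \o lcofree_coact) (g := idfun)) => c v.
rewrite -[LHS]/(contr_l counit (lcofree_coact (tens c v))) lcofree_coactE.
rewrite contr_l_tmap -[RHS]/(tens c v).
by have -> : contr_l (counit \o idfun) (comul c) = c by exact: counitl.
Qed.

Definition lcofree : lcomod C := LComod lcofreeA lcofree1.

End Left.

Lemma lcoact_hom (N : lcomod C) : @lcomod_hom k C N (lcofree N) lcoact.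
Proof.
by move=> n; rewrite -[LHS]/(lcofree_coact N (lcoact n)) lcofree_tassoc lcoactA.
Qed.

Lemma injective_lcomod_retraction (E : lcomod C) :
  @injective_obj k (lcomod_cat C) (fun _ => True) E ->
  exists p : {linear tensor C E -> E},
    (forall a c e, lcomod_act E a (p (tens c e)) = p (tens (contr_l a (comul c)) e)) /\
    (forall e, p (lcoact e) = e).
Proof.
move=> [_ /(_ E (lcofree E) lcoact idfun I I)].
move=> /(_ (@lcoact_hom E)) [||p pH pK].
- by move=> x y xy; rewrite -[x]lcoact1 xy lcoact1.
- exact: (@lcomod_hom_id k C E).
exists p; split=> // a c e; rewrite -[LHS]/(contr_l a (lcoact (p (tens c e)))).
rewrite pH contr_l_tmap; congr (p _).
rewrite -[LHS]/(contr_l (a \o idfun) (lcofree_coact E (tens c e))) lcofree_coactE.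
rewrite contr_l_tmap -[LHS]/(tens _ e); congr (tens _ e).
Qed.

End Cofree.

(** * Making a linear map equivariant *)

Section Averaging.
Variables (k : fieldType) (C : coalgebra k) (Y V : lmodType k).
Variables (actY : dual C -> Y -> Y) (actV : dual C -> {linear V -> V}).
Variables (rhoY : {linear Y -> tensor Y C}) (rhoV : {linear V -> tensor V C}).
Hypothesis rhoYE : forall a y, contr_r a (rhoY y) = actY a y.
Hypothesis rhoVE : forall a v, contr_r a (rhoV v) = actV a v.
(** [delta a] stands for the action of [a] on [C] from either side, and [actYA] for the composition
    law of that side, so left and right actions share one argument. *)
Variables (s : {linear tensor V C -> V}) (delta : dual C -> {linear C -> C}).
Hypothesis act_s : forall a v c, actV a (s (tens v c)) = s (tens v (delta a c)).
Hypothesis sK : forall v, s (rhoV v) = v.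
Hypothesis actYA : forall (a b d : dual C) y, (forall c, d c = b (delta a c)) ->
  actY b (actY a y) = actY d y.
Variable phi : {linear Y -> V}.

(* The map y |-> \sum s (phi y_0 (x) y_1): a comodule retraction [s] of the
   coaction of V turns a linear map into an equivariant one. *)
Definition average : {linear Y -> V} := s \o tmap phi idfun \o rhoY.

Lemma average_act a y : average (actY a y) = actV a (average y).
Proof.
have -> : average (actY a y) = s (tmap idfun (delta a) (tmap phi idfun (rhoY y))).
  congr (s _); apply: eq_tensor_r => b.
  by rewrite !contr_r_tmap /= !rhoYE; congr (phi _); apply: actYA.
rewrite -[average y]/(s (tmap phi idfun (rhoY y))); set t := tmap _ _ _.
by apply: (tens_eq (f := s \o tmap idfun (delta a)) (g := actV a \o s)) => v c;
  rewrite -[RHS]/(actV a (s (tens v c))) act_s -[LHS]/(s (tmap _ _ _)) tmapE.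
Qed.

(** Where [phi] is already equivariant, [phi (x) 1] carries [rhoY y] to [rhoV (phi y)], which [s]
    sends back to [phi y]. *)
Lemma average_id y : (forall b, phi (actY b y) = actV b (phi y)) -> average y = phi y.
Proof.
move=> phi_act; rewrite -[RHS]sK; congr (s _); apply: eq_tensor_r => b.
rewrite contr_r_tmap rhoVE -phi_act -rhoYE; congr (phi (contr_r _ _)).
Qed.

(** [r] and [r'] are meant to be the actions of one element on the opposite side: averaging on one
    side preserves linearity on the other. *)
Lemma average_comm (r : {linear Y -> Y}) (r' : {linear V -> V}) y :
  (forall y, phi (r y) = r' (phi y)) ->
  (forall v c, r' (s (tens v c)) = s (tens (r' v) c)) ->
  (forall a y, actY a (r y) = r (actY a y)) ->
  average (r y) = r' (average y).
Proof.
move=> phi_r r's actr.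
have -> : average (r y) = s (tmap r' idfun (tmap phi idfun (rhoY y))).
  congr (s _); apply: eq_tensor_r => b.
  rewrite !contr_r_tmap /= !rhoYE actr phi_r.
  by congr (r' (phi (actY _ _))); apply: dual_ext.
rewrite -[average y]/(s (tmap phi idfun (rhoY y))); set t := tmap _ _ _.
by apply: (tens_eq (f := s \o tmap r' idfun) (g := r' \o s)) => v c;
  rewrite -[RHS]/(r' (s (tens v c))) r's -[LHS]/(s (tmap _ _ _)) tmapE.
Qed.

End Averaging.

Section TensorInjective.
Variables (k : fieldType) (C : coalgebra k).

Lemma lact_coaction (B : bimod C) : rational B ->
  exists rho : {linear B -> tensor B C}, forall a b, contr_r a (rho b) = lact a b.
Proof.
move=> /rational_seqP ratB; apply: (@exists_coaction k C B (fun a b => lact a b)).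
- by move=> b x y z; rewrite linearPl.
- by move=> a x y z; rewrite linearPr.
by move=> b; have [s sb] := ratB b; exists s => a /sb[].
Qed.

(** The right action is also encoded with [C] as the right factor, so that the same averaging
    applies to it. *)
Lemma ract_coaction (B : bimod C) : rational B ->
  exists rho : {linear B -> tensor B C}, forall a b, contr_r a (rho b) = ract b a.
Proof.
move=> /rational_seqP ratB; apply: (@exists_coaction k C B (fun a b => ract b a)).
- by move=> b x y z; rewrite linearPr.
- by move=> a x y z; rewrite linearPl.
by move=> b; have [s sb] := ratB b; exists s => a /sb[].
Qed.

Variables (V W : lmodType k).

Section Right.
Variable p : {linear tensor V C -> V}.

(** Fixing [c] in [p] makes [(v (x) w) (x) c |-> p (v (x) c) (x) w] definable as [extend_r], with no
    permutation of three factors. *)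
Definition fiber_r (c : C) : {linear V -> V} := p \o tensr V c.
Definition extend_r_fun (t : tensor V W) (c : C) : tensor V W :=
  tmap (fiber_r c) idfun t.

Fact extend_r_bilinear : bilinear_for *:%R *:%R extend_r_fun.
Proof.
split=> [c|t] a x y; first by rewrite /extend_r_fun linearP.
by apply: tmap_linl => v; rewrite /= linearPr linearP.
Qed.

Definition extend_r : {linear tensor (tensor V W) C -> tensor V W} :=
  tlift (bilinear_of extend_r_bilinear).

Lemma extend_rE t c : extend_r (tens t c) = tmap (fiber_r c) idfun t.
Proof. by rewrite [LHS]tliftE. Qed.

Lemma extend_r_tensr w t : extend_r (tmap (tensr V w) idfun t) = tens (p t) w.
Proof.
apply: (tens_eq (f := extend_r \o tmap (tensr V w) idfun) (g := tensr V w \o p)) => v c.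
rewrite -[LHS]/(extend_r (tmap _ _ (tens v c))) tmapE.
by rewrite -[LHS]/(extend_r (tens (tens v w) c)) extend_rE tmapE.
Qed.

End Right.

Section Left.
Variable p : {linear tensor C W -> W}.

Definition fiber_l (c : C) : {linear W -> W} := p \o tensl W c.
Definition extend_l_fun (t : tensor V W) (c : C) : tensor V W :=
  tmap idfun (fiber_l c) t.

Fact extend_l_bilinear : bilinear_for *:%R *:%R extend_l_fun.
Proof.
split=> [c|t] a x y; first by rewrite /extend_l_fun linearP.
by apply: tmap_linr => v; rewrite /= linearPl linearP.
Qed.

Definition extend_l : {linear tensor (tensor V W) C -> tensor V W} :=
  tlift (bilinear_of extend_l_bilinear).

Lemma extend_lE t c : extend_l (tens t c) = tmap idfun (fiber_l c) t.
Proof. by rewrite [LHS]tliftE. Qed.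

(** Brings a left coaction on [W] to the form of [ract_coaction], with [C] on the right. *)
Definition swap_tensl_fun (v : V) (c : C) (w : W) : tensor (tensor V W) C :=
  tens (tens v w) c.

Fact swap_tensl_bilinear v : bilinear_for *:%R *:%R (swap_tensl_fun v).
Proof.
by split=> [c|w] a x y; rewrite /swap_tensl_fun ?linearPr ?linearPl.
Qed.

Definition swap_tensl v : {linear tensor C W -> tensor (tensor V W) C} :=
  tlift (bilinear_of (swap_tensl_bilinear v)).

Lemma swap_tenslE v c w : swap_tensl v (tens c w) = tens (tens v w) c.
Proof. by rewrite [LHS]tliftE. Qed.

Lemma contr_r_swap v (g : {scalar C}) t :
  contr_r g (swap_tensl v t) = tens v (contr_l g t).
Proof.
apply: (tens_eq (f := contr_r g \o swap_tensl v) (g := tensl W v \o contr_l g)) => c w.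
rewrite -[LHS]/(contr_r g (swap_tensl v (tens c w))) swap_tenslE contr_rE.
by rewrite -[RHS]/(tens v (contr_l g (tens c w))) contr_lE linearZr_LR.
Qed.

Lemma extend_l_swap v t : extend_l (swap_tensl v t) = tens v (p t).
Proof.
apply: (tens_eq (f := extend_l \o swap_tensl v) (g := tensl W v \o p)) => c w.
rewrite -[LHS]/(extend_l (swap_tensl v (tens c w))) swap_tenslE extend_lE tmapE.
by [].
Qed.

End Left.

End TensorInjective.

Section InjectiveTensor.
Variables (k : fieldType) (C : coalgebra k).

Lemma tensor_bimod_injective (E1 : rcomod C) (E2 : lcomod C) :
  @injective_obj k (rcomod_cat C) (fun _ => True) E1 ->
  @injective_obj k (lcomod_cat C) (fun _ => True) E2 ->
  @injective_obj k (bimod_cat C) (@rational k C) (tensor_bimod E1 E2).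
Proof.
move=> /injective_rcomod_retraction[p1 [act_p1 p1K]].
move=> /injective_lcomod_retraction[p2 [act_p2 p2K]].
have ratV := @tensor_bimod_rational k C E1 E2.
split=> // X Y i f ratX ratY iH i_inj fH.
have [r iK] := linear_retraction i_inj.
have [rhoYl rhoYlE] := lact_coaction ratY.
have [rhoYr rhoYrE] := ract_coaction ratY.
have [rhoVl rhoVlE] := lact_coaction ratV.
have [rhoVr rhoVrE] := ract_coaction ratV.
pose V := tensor E1 E2.
pose actl a : {linear V -> V} := tmap (rcomod_act E1 a) idfun.
pose actr a : {linear V -> V} := tmap idfun (lcomod_act E2 a).
pose dl (a : dual C) : {linear C -> C} := contr_r a \o comul.
pose dr (a : dual C) : {linear C -> C} := contr_l a \o comul.
pose s1 := extend_r E2 p1; pose s2 := extend_l E1 p2.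
have act_s1 a v c : actl a (s1 (tens v c)) = s1 (tens v (dl a c)).
  rewrite /s1 !extend_rE tmap_comp; apply: eq_tmap => // e.
  exact: act_p1.
have act_s2 a v c : actr a (s2 (tens v c)) = s2 (tens v (dr a c)).
  rewrite /s2 !extend_lE tmap_comp; apply: eq_tmap => // e.
  exact: act_p2.
have s1K v : s1 (rhoVl v) = v.
  apply: (tens_eq (f := s1 \o rhoVl) (g := idfun)) => e1 e2.
  rewrite -[LHS]/(s1 (rhoVl (tens e1 e2))).
  (* [rhoVl] comes from an existence statement, but its contractions are the left actions, which
     identify it. *)
  have -> : rhoVl (tens e1 e2) = tmap (tensr E1 e2) idfun (rcoact e1).
    apply: eq_tensor_r => g; rewrite rhoVlE contr_r_tmap -[LHS]/(tmap _ _ _) tmapE.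
    by congr (tens _ e2).
  by rewrite /s1 extend_r_tensr p1K.
have s2K v : s2 (rhoVr v) = v.
  apply: (tens_eq (f := s2 \o rhoVr) (g := idfun)) => e1 e2.
  rewrite -[LHS]/(s2 (rhoVr (tens e1 e2))).
  have -> : rhoVr (tens e1 e2) = swap_tensl C E2 e1 (lcoact e2).
    apply: eq_tensor_r => g; rewrite rhoVrE contr_r_swap -[LHS]/(tmap _ _ _) tmapE.
    by congr (tens e1 _).
  by rewrite /s2 extend_l_swap p2K.
have actl_comp (a b d : dual C) (y : Y) : (forall c, d c = b (dl a c)) ->
    lact b (lact a y) = lact d y.
  by move=> dE; rewrite -lactM; congr (lact _ y); apply: dual_ext => c; rewrite dE.
have actr_comp (a b d : dual C) (y : Y) : (forall c, d c = b (dr a c)) ->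
    ract (ract y a) b = ract y d.
  move=> dE; rewrite -ractM; congr (ract y _); apply: dual_ext => c; rewrite dE.
  exact: contr_lr.
(* [f \o r] extends [f] only linearly; [phi1] respects the left action and [phi2] both. *)
pose phi1 := average (rhoYl) s1 (f \o r).
pose phi2 := average (rhoYr) s2 phi1.
have phi1_lact a y : phi1 (lact a y) = actl a (phi1 y).
  exact: (average_act rhoYlE act_s1 actl_comp).
have phi1_i x : phi1 (i x) = f x.
  rewrite -[in RHS](iK x); apply: (average_id (actV := actl) rhoYlE rhoVlE s1K) => b.
  by rewrite -(iH b x).1 /= !iK (fH b x).1.
have phi2_ract a y : phi2 (ract y a) = actr a (phi2 y).
  exact: (average_act rhoYrE act_s2 actr_comp).
have phi2_i x : phi2 (i x) = f x.
  rewrite -phi1_i; apply: (average_id (actV := actr) rhoYrE rhoVrE s2K) => b.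
  by rewrite -(iH b x).2 !phi1_i (fH b x).2.
have phi2_lact a y : phi2 (lact a y) = actl a (phi2 y).
  apply: (average_comm (r := lact a) rhoYrE) => [z|v c|b z].
  - exact: phi1_lact.
  - by rewrite /s2 !extend_lE !tmap_comp; apply: eq_tmap.
  by rewrite lractA.
by exists phi2.
Qed.

End InjectiveTensor.

(** * Comparison of injective resolutions *)

Section Cohomology.
Variable k : fieldType.

Lemma inj_surj_bijective (T U : Type) (f : T -> U) :
  injective f -> (forall y, exists x, f x = y) -> bijective f.
Proof.
by move=> f_inj /choice[g gK]; exists g => // x; apply: f_inj.
Qed.

Lemma lin_iso_trans (U V W : lmodType k) : lin_iso U V -> lin_iso V W -> lin_iso U W.
Proof. by move=> [f f_bij] [g g_bij]; exists (g \o f); apply: bij_comp. Qed.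

Lemma quotsp_map (U V : lmodType k) (S : submodClosed U) (T : submodClosed V)
    (f : {linear U -> V}) : (forall x, x \in S -> f x \in T) ->
  exists g : {linear quotsp S -> quotsp T}, forall x, g (qproj S x) = qproj T (f x).
Proof.
move=> fST; have [r rP] := generalized_inverse (qproj S).
exists (qproj T \o f \o r) => x; apply/qproj_eq; rewrite -linearB; apply: fST.
exact/qproj_eq/rP.
Qed.

(** A single map in degree [n], with conditions on cocycles and coboundaries there, because the
    comparison maps between resolutions are obtained degree by degree. *)
Lemma lin_iso_cohomology (X Y : cochain k) n (f : {linear X n -> Y n}) :
  (forall x, cdiff X n x = 0 -> cdiff Y n (f x) = 0) ->
  (forall x, cdiff X n x = 0 -> coboundary x <-> coboundary (f x)) ->
  (forall y, cdiff Y n y = 0 ->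
     exists2 x, cdiff X n x = 0 & coboundary (f x - y)) ->
  lin_iso (cohomology X n) (cohomology Y n).
Proof.
move=> fZ fB fsurj.
have fker x : x \in ker (cdiff X n) -> f x \in ker (cdiff Y n).
  by move=> /kerP/fZ ?; apply/kerP.
pose fz : {linear cocycles X n -> cocycles Y n} := submap fker.
have fzB z : z \in @coboundary_pred k X n <-> fz z \in @coboundary_pred k Y n.
  have zZ : cdiff X n (incl z) = 0 by apply/kerP/inclP.
  by split=> /asboolP zB; apply/asboolP; move: zB; rewrite submapE => /(fB _ zZ).
have [g gE] := quotsp_map (fun z => proj1 (fzB z)).
exists g; apply: inj_surj_bijective => [u v|v].
  have [x ->] := qproj_surj u; have [y ->] := qproj_surj v.
  by rewrite !gE => /qproj_eq; rewrite -linearB => /fzB/qproj_eq.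
have [y ->] := qproj_surj v.
have [|x xZ xB] := fsurj (incl y); first by apply/kerP/inclP.
have xK : x \in ker (cdiff X n) by apply/kerP.
exists (qproj (@coboundary_pred k X n) (subsp_of xK)); rewrite gE.
by apply/qproj_eq/asboolP; rewrite linearB submapE subsp_ofK.
Qed.

End Cohomology.

Section SubBimodule.
Variables (k : fieldType) (C : coalgebra k) (B : bimod C) (S : submodClosed B).
Hypothesis S_lact : forall a b, b \in S -> lact a b \in S.
Hypothesis S_ract : forall a b, b \in S -> ract b a \in S.

Definition sub_lact_fun (a : dual C) (x : subsp S) : subsp S :=
  subsp_of (S_lact a (inclP x)).
Definition sub_ract_fun (x : subsp S) (a : dual C) : subsp S :=
  subsp_of (S_ract a (inclP x)).

Fact sub_lact_bilinear : bilinear_for *:%R *:%R sub_lact_fun.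
Proof.
split=> [x|a] c y z; apply: incl_inj; rewrite [RHS]linearP !subsp_ofK.
  by rewrite linearPl.
by rewrite linearPr.
Qed.

Fact sub_ract_bilinear : bilinear_for *:%R *:%R sub_ract_fun.
Proof.
split=> [a|x] c y z; apply: incl_inj; rewrite [RHS]linearP !subsp_ofK.
  by rewrite linearPl.
by rewrite linearPr.
Qed.

Definition sub_lact := bilinear_of sub_lact_bilinear.
Definition sub_ract := bilinear_of sub_ract_bilinear.

Fact sub_lactM a b x : sub_lact (a * b) x = sub_lact a (sub_lact b x).
Proof. by apply: incl_inj; apply: lactM. Qed.
Fact sub_lact1 x : sub_lact 1 x = x.
Proof. by apply: incl_inj; apply: lact1. Qed.
Fact sub_ractM a b x : sub_ract x (a * b) = sub_ract (sub_ract x a) b.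
Proof. by apply: incl_inj; apply: ractM. Qed.
Fact sub_ract1 x : sub_ract x 1 = x.
Proof. by apply: incl_inj; apply: ract1. Qed.
Fact sub_lractA a b x : sub_ract (sub_lact a x) b = sub_lact a (sub_ract x b).
Proof. by apply: incl_inj; apply: lractA. Qed.

Definition sub_bimod : bimod C := @Bimod k C (subsp S) sub_lact sub_ract
  sub_lactM sub_lact1 sub_ractM sub_ract1 sub_lractA.

Lemma incl_hom : @bimod_hom k C sub_bimod B incl.
Proof. by []. Qed.

Lemma sub_bimod_rational : rational B -> rational sub_bimod.
Proof.
move=> ratB x; have [D [fdD xD]] := ratB (incl x); exists D; split=> // a /xD[lx rx].
by split; apply: incl_inj; rewrite linear0.
Qed.

End SubBimodule.

(** * Resolutions are unique up to homotopy *)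

Section Comparison.
Variables (k : fieldType) (C : coalgebra k).
Local Notation rat := (@rational k C).

(** [f] kills the kernel of [d], so it descends to the image of [d]. This image is a sub-bimodule of
    [Y], hence rational, and injectivity of [J] extends the map from it to [Y]. *)
Lemma injective_extension (X Y J : bimod C)
    (d : {linear X -> Y}) (f : {linear X -> J}) :
  @injective_obj k (bimod_cat C) rat J -> rational Y ->
  bimod_hom d -> bimod_hom f -> (forall x, d x = 0 -> f x = 0) ->
  exists2 g : {linear Y -> J}, bimod_hom g & forall x, g (d x) = f x.
Proof.
move=> [_ injJ] ratY dH fH df.
have [r rP] := generalized_inverse d.
pose S := lin_image d.
have Sl a y : y \in S -> lact a y \in S.
  by move=> /lin_imageP[x ->]; apply/lin_imageP; exists (lact a x); rewrite (dH a x).1.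
have Sr a y : y \in S -> ract y a \in S.
  by move=> /lin_imageP[x ->]; apply/lin_imageP; exists (ract x a); rewrite (dH a x).2.
have frd x : f (r (d x)) = f x.
  by apply/eqP; rewrite -subr_eq0 -linearB df // linearB rP subrr.
pose fS : {linear sub_bimod Sl Sr -> J} := f \o r \o incl.
have [|||g gH gE] := injJ (sub_bimod Sl Sr) Y incl fS (sub_bimod_rational ratY) ratY.
- exact: incl_hom.
- exact: incl_inj.
- move=> a y; have /lin_imageP[x yE] : incl y \in S by apply: inclP.
  split; rewrite -[LHS]/(f (r (incl _))) -[fS y]/(f (r (incl y))).
    by rewrite -[incl (lact a y)]/(lact a (incl y)) yE -(dH a x).1 !frd (fH a x).1.
  by rewrite -[incl (ract y a)]/(ract (incl y) a) yE -(dH a x).2 !frd (fH a x).2.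
exists g => // x.
have dxS : d x \in S by apply/lin_imageP; exists x.
by have := gE (subsp_of dxS : sub_bimod Sl Sr); rewrite /= => ->; rewrite /fS /= frd.
Qed.

Variable B : bimod C.
Implicit Types E F G : rational_injres B.
Local Notation "E '@@' n" := (rterm E n : bimod C) (at level 10).

Lemma raug_lift E (x : E @@ 0) : rdiff E 0 x = 0 -> exists b : B, x = raug E b.
Proof. exact: (proj1 (@raug_exact _ _ _ _ E x)). Qed.

Lemma rdiff_aug E (b : B) : rdiff E 0 (raug E b) = 0.
Proof. by apply: (proj2 (@raug_exact _ _ _ _ E _)); exists b. Qed.

Lemma rdiff_lift E n (x : E @@ n.+1) :
  rdiff E n.+1 x = 0 -> exists y : E @@ n, x = rdiff E n y.
Proof. exact: (proj1 (@rdiff_exact _ _ _ _ E n x)). Qed.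

Lemma rdiff_rdiff E n (x : E @@ n) : rdiff E n.+1 (rdiff E n x) = 0.
Proof. exact: (rdiffK (K := bimod_cat C)). Qed.

(* [f] is the n-th component of a morphism of resolutions over the identity. *)
Fixpoint lifts_id E F n : {linear E @@ n -> F @@ n} -> Prop :=
  match n with
  | 0 => fun f => forall b, f (raug E b) = raug F b
  | m.+1 => fun f => exists f' : {linear E @@ m -> F @@ m},
      [/\ bimod_hom f', lifts_id f' & forall x, f (rdiff E m x) = rdiff F m (f' x)]
  end.

Lemma lifts_id_step E F n (f : {linear E @@ n -> F @@ n}) :
  bimod_hom f -> lifts_id f ->
  exists g : {linear E @@ n.+1 -> F @@ n.+1},
    bimod_hom g /\ forall x, g (rdiff E n x) = rdiff F n (f x).
Proof.
move=> fH fL.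
have [||x x0|g gH gE] := @injective_extension (E @@ n) (E @@ n.+1) (F @@ n.+1)
    (rdiff E n) (rdiff F n \o f) (rterm_injective F n.+1) (rterm_injective E n.+1).1.
- exact: (rdiff_hom E n).
- exact: (bimod_hom_comp fH (rdiff_hom F n)).
(* By exactness a cocycle comes from the previous degree, or from [B] in degree 0, where the
   compatibility recorded in [lifts_id] applies. *)
- case: n f fH fL x x0 => [|n] f fH /=.
    by move=> fb x /raug_lift[b ->]; rewrite fb rdiff_aug.
  by move=> [f' [_ _ ff']] x /rdiff_lift[y ->]; rewrite ff' rdiff_rdiff.
by exists g.
Qed.

Lemma exists_lifts_id E F n :
  exists f : {linear E @@ n -> F @@ n}, bimod_hom f /\ lifts_id f.
Proof.
elim: n => [|n [f [fH fL]]]; last first.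
  have [g [gH gE]] := lifts_id_step fH fL.
  by exists g; split=> //; exists f.
have [||x x0|g gH gE] := @injective_extension B (E @@ 0) (F @@ 0)
    (raug E) (raug F) (rterm_injective F 0) (rterm_injective E 0).1.
- exact: (raug_hom E).
- exact: (raug_hom F).
- have -> : x = 0 by apply: (raug_injective (i := E)); rewrite x0 linear0.
  exact: linear0.
by exists g.
Qed.

Lemma lifts_id_comp E F G n
    (f : {linear E @@ n -> F @@ n}) (g : {linear F @@ n -> G @@ n}) :
  bimod_hom f -> bimod_hom g -> lifts_id f -> lifts_id g ->
  lifts_id (g \o f : {linear E @@ n -> G @@ n}).
Proof.
elim: n f g => [|n IHn] f g fH gH /=; first by move=> fb gb b; rewrite fb gb.
move=> [f' [fH' fL' fE]] [g' [gH' gL' gE]]; exists (g' \o f'); split.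
- exact: bimod_hom_comp.
- exact: IHn.
by move=> x /=; rewrite fE gE.
Qed.

Lemma lifts_id_idfun E n : lifts_id (idfun : {linear E @@ n -> E @@ n}).
Proof.
elim: n => [|n IHn] //=; exists idfun; split=> //.
Qed.

(* The components in degrees n-1 and n of a homotopy; asking for no
   compatibility with the lower ones makes plain induction on n sufficient. *)
Definition homotopic E F n :
    {linear E @@ n -> F @@ n} -> {linear E @@ n -> F @@ n} -> Prop :=
  match n with
  | 0 => fun f g => exists h : {linear E @@ 1 -> F @@ 0},
      bimod_hom h /\ forall x, f x - g x = h (rdiff E 0 x)
  | m.+1 => fun f g => exists (h : {linear E @@ m.+2 -> F @@ m.+1})
      (h' : {linear E @@ m.+1 -> F @@ m}),
      [/\ bimod_hom h, bimod_hom h' &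
        forall x, f x - g x = h (rdiff E m.+1 x) + rdiff F m (h' x)]
  end.

Lemma bimod_homB (X Y : bimod C) (f g : {linear X -> Y}) :
  bimod_hom f -> bimod_hom g -> bimod_hom (f \- g).
Proof.
move=> fH gH a x; rewrite /= (fH a x).1 (fH a x).2 (gH a x).1 (gH a x).2.
by rewrite linearBr linearBl.
Qed.

Lemma lifts_id_homotopic E F n (f g : {linear E @@ n -> F @@ n}) :
  bimod_hom f -> bimod_hom g -> lifts_id f -> lifts_id g -> homotopic f g.
Proof.
elim: n f g => [|n IHn] f g fH gH.
  move=> fL gL.
  have [||x|h hH hE] := @injective_extension (E @@ 0) (E @@ 1) (F @@ 0)
    (rdiff E 0) (f \- g) (rterm_injective F 0) (rterm_injective E 1).1.
  - exact: (rdiff_hom E 0).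
  - exact: bimod_homB.
  - by move=> /raug_lift[b ->] /=; rewrite fL gL subrr.
  by exists h; split=> // x; rewrite hE.
move=> [f' [fH' fL' fE]] [g' [gH' gL' gE]].
(* Applying the differential to the homotopy in degree [n] removes its second summand, so only [h]
   remains, in degree 0 and above alike. *)
have [h [hH hE]] : exists h : {linear E @@ n.+1 -> F @@ n}, bimod_hom h /\
    forall x, rdiff F n (f' x - g' x) = rdiff F n (h (rdiff E n x)).
  have := IHn f' g' fH' gH' fL' gL'.
  case: n f g fH gH f' g' {fH' fL' fE gH' gL' gE IHn} => [|n] f g fH gH f' g'.
    by move=> [h [hH hE]]; exists h; split=> // x; rewrite hE.
  move=> [h [h' [hH _ hE]]]; exists h; split=> // x; rewrite hE linearD.
  by rewrite rdiff_rdiff addr0.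
have [|||e eH eE] := @injective_extension (E @@ n.+1) (E @@ n.+2) (F @@ n.+1)
  (rdiff E n.+1) ((f \- g) \- (rdiff F n \o h)) (rterm_injective F n.+1)
  (rterm_injective E n.+2).1.
- exact: (rdiff_hom E n.+1).
- apply: bimod_homB; first exact: bimod_homB.
  exact: (bimod_hom_comp hH (rdiff_hom F n)).
- move=> x /rdiff_lift[y ->] /=; rewrite fE gE -hE linearB; exact: subrr.
by exists e, h; split=> // x; rewrite eE /= subrK.
Qed.

Definition center_map E F n (f : {linear E @@ n -> F @@ n}) (fH : bimod_hom f) :
    {linear center_complex E n -> center_complex F n} := submap (center_stable fH).

Lemma center_map_cocycle E F n (f : {linear E @@ n -> F @@ n}) (fH : bimod_hom f) x :
  lifts_id f -> cdiff (center_complex E) n x = 0 ->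
  cdiff (center_complex F) n (center_map fH x) = 0.
Proof.
move=> fL /(congr1 incl) x0; have [g [gH gE]] := lifts_id_step fH fL.
apply: incl_inj; rewrite linear0 -[LHS]/(rdiff F n (f (incl x))) -gE.
by rewrite -[rdiff E n _]/(incl (cdiff (center_complex E) n x)) x0 !linear0.
Qed.

Lemma center_map_coboundary E F n (f : {linear E @@ n -> F @@ n}) (fH : bimod_hom f) x :
  lifts_id f -> coboundary x -> coboundary (center_map fH x).
Proof.
case: n f fH x => [|n] f fH x /=; first by move=> _ ->; rewrite linear0.
move=> [g [gH gL fE]] [y ->]; exists (center_map gH y); apply: incl_inj.
exact: fE.
Qed.

Lemma center_map_homotopic E F n (f g : {linear E @@ n -> F @@ n})
    (fH : bimod_hom f) (gH : bimod_hom g) x :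
  homotopic f g -> cdiff (center_complex E) n x = 0 ->
  coboundary (center_map fH x - center_map gH x).
Proof.
move=> fg /(congr1 incl) x0; have {}x0 : rdiff E n (incl x) = 0 := x0.
case: n f g fH gH x x0 fg => [|n] f g fH gH x x0 /=.
  move=> [h [_ hE]]; apply: incl_inj; rewrite linearB linear0.
  by rewrite -[LHS]/(f (incl x) - g (incl x)) hE x0 linear0.
move=> [h [h' [_ hH' hE]]].
exists (submap (center_stable hH') x); apply: incl_inj; rewrite linearB.
by rewrite -[LHS]/(f (incl x) - g (incl x)) hE x0 linear0 add0r.
Qed.

Lemma Hctn_unique E F n : lin_iso (Hctn E n) (Hctn F n).
Proof.
have [f [fH fL]] := exists_lifts_id E F n.
have [g [gH gL]] := exists_lifts_id F E n.
have gfh : homotopic (g \o f : {linear E @@ n -> E @@ n}) idfun.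
  apply: lifts_id_homotopic; [exact: bimod_hom_comp|by []| |exact: lifts_id_idfun].
  exact: lifts_id_comp.
have fgh : homotopic (f \o g : {linear F @@ n -> F @@ n}) idfun.
  apply: lifts_id_homotopic; [exact: bimod_hom_comp|by []| |exact: lifts_id_idfun].
  exact: lifts_id_comp.
apply: (@lin_iso_cohomology k _ _ n (center_map fH)) => [x|x x0|y y0].
- exact: center_map_cocycle.
- split=> [|fxB]; first exact: center_map_coboundary.
  have gfB := center_map_homotopic (bimod_hom_comp fH gH) (@bimod_hom_id k C _) gfh x0.
  (* Injectivity on cohomology: [x] differs from [g (f x)] by a coboundary, and [g] maps the
     coboundary [f x] to a coboundary. *)
  have -> : x = (-1) *: (center_map (bimod_hom_comp fH gH) x -
      center_map (@bimod_hom_id k C _) x) + center_map gH (center_map fH x).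
    apply: incl_inj; rewrite linearP scaleN1r linearB.
    rewrite -[incl (center_map gH _)]/(g (f (incl x))).
    rewrite -[incl (center_map (bimod_hom_comp _ _) _)]/(g (f (incl x))).
    rewrite -[incl (center_map (@bimod_hom_id _ _ _) _)]/(incl x).
    by rewrite opprK addrAC addNr add0r.
  by apply: coboundary_linear => //; apply: center_map_coboundary.
exists (center_map gH y); first exact: center_map_cocycle.
have := center_map_homotopic (bimod_hom_comp gH fH) (@bimod_hom_id k C _) fgh y0.
by congr coboundary; apply: incl_inj; rewrite !linearB.
Qed.

End Comparison.

(** * The total complex of a tensor product of resolutions *)

Section Contraction.
Variables (k : fieldType) (V : lmodType k) (U : nat -> lmodType k).
Variables (e : {linear V -> U 0}) (d : forall n, {linear U n -> U n.+1}).

(** Generalized inverses [s] alone need not form a contraction. Since [x - s (d x)] is a cocycle,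
    hence in the image of the previous differential, [s] is applied to it instead of [x]; this is
    [t], and [t] agrees with [s] on boundaries. *)
Lemma exact_contraction : injective e ->
  (forall x, d 0 x = 0 <-> exists v, x = e v) ->
  (forall n x, d n.+1 x = 0 <-> exists y, x = d n y) ->
  exists (r : {linear U 0 -> V}) (t : forall n, {linear U n.+1 -> U n}),
    (forall x, x = t 0 (d 0 x) + e (r x)) /\
    (forall n x, x = t n.+1 (d n.+1 x) + d n (t n x)).
Proof.
move=> e_inj ex0 exS.
have [r0 r0K] := linear_retraction e_inj.
pose s n := sval (cid (generalized_inverse (d n))).
have sP n x : d n (s n (d n x)) = d n x := svalP (cid (generalized_inverse (d n))) x.
pose t n : {linear U n.+1 -> U n} := s n \o (idfun \- (s n.+1 \o d n.+1)).
have td n x : t n (d n x) = s n (d n x).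
  have ddx : d n.+1 (d n x) = 0 by apply/exS; exists x.
  by rewrite /t /= ddx linear0 subr0.
exists (r0 \o (idfun \- (s 0 \o d 0))), t; split=> [x|n x]; rewrite td.
  have /ex0[v xv] : d 0 (x - s 0 (d 0 x)) = 0 by rewrite linearB sP subrr.
  rewrite -[X in e X]/(r0 (x - s 0 (d 0 x))) xv r0K -xv.
  by rewrite addrC subrK.
have /exS[y xy] : d n.+1 (x - s n.+1 (d n.+1 x)) = 0 by rewrite linearB sP subrr.
rewrite -[t n x]/(s n (x - s n.+1 (d n.+1 x))) xy sP -xy.
by rewrite addrC subrK.
Qed.

End Contraction.

Section TensorTotal.
Variable k : fieldType.

Lemma tmapDl (V W V' W' : lmodType k) (f f1 f2 : {linear V -> V'})
    (g : {linear W -> W'}) t :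
  (forall v, f v = f1 v + f2 v) -> tmap f g t = tmap f1 g t + tmap f2 g t.
Proof.
move=> fE; rewrite (@tmap_linl _ _ _ _ _ 1 f f1 f2) ?scale1r // => v.
by rewrite scale1r.
Qed.

Lemma tmapDr (V W V' W' : lmodType k) (f : {linear V -> V'})
    (g g1 g2 : {linear W -> W'}) t :
  (forall w, g w = g1 w + g2 w) -> tmap f g t = tmap f g1 t + tmap f g2 t.
Proof.
move=> gE; rewrite (@tmap_linr _ _ _ _ _ 1 f g g1 g2) ?scale1r // => w.
by rewrite scale1r.
Qed.

Variables (V V' : lmodType k) (U U' : nat -> lmodType k).
Variables (e : {linear V -> U 0}) (d : forall n, {linear U n -> U n.+1}).
Variables (e' : {linear V' -> U' 0}) (d' : forall n, {linear U' n -> U' n.+1}).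
Hypothesis ddK : forall n x, d n.+1 (d n x) = 0.
Hypothesis ddK' : forall n x, d' n.+1 (d' n x) = 0.

Definition tensor_hdiff p q : {linear tensor (U p) (U' q) -> tensor (U p.+1) (U' q)} :=
  tmap (d p) idfun.
Definition tensor_vdiff p q : {linear tensor (U p) (U' q) -> tensor (U p) (U' q.+1)} :=
  tmap idfun (d' q).

Fact tensor_hdiffK p q x : tensor_hdiff p.+1 q (tensor_hdiff p q x) = 0.
Proof. by rewrite tmap_comp; apply: tmap0l => u; apply: ddK. Qed.
Fact tensor_vdiffK p q x : tensor_vdiff p q.+1 (tensor_vdiff p q x) = 0.
Proof. by rewrite tmap_comp; apply: tmap0r => u; apply: ddK'. Qed.
Fact tensor_hvdiff p q x :
  tensor_hdiff p q.+1 (tensor_vdiff p q x) = tensor_vdiff p.+1 q (tensor_hdiff p q x).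
Proof. by rewrite !tmap_comp; apply: eq_tmap. Qed.

Definition tensor_bicomplex : bicomplex k :=
  Bicomplex tensor_hdiffK tensor_vdiffK tensor_hvdiff.

Local Notation X := tensor_bicomplex.
Local Notation P := (dprod (fun i : nat * nat => X i.1 i.2)).

Variables (r : {linear U 0 -> V}) (t : forall n, {linear U n.+1 -> U n}).
Variables (r' : {linear U' 0 -> V'}) (t' : forall n, {linear U' n.+1 -> U' n}).
Hypotheses (de : forall v, d 0 (e v) = 0).
Hypotheses (t0 : forall x, x = t 0 (d 0 x) + e (r x))
  (tS : forall n x, x = t n.+1 (d n.+1 x) + d n (t n x)).
Hypotheses (t0' : forall x, x = t' 0 (d' 0 x) + e' (r' x))
  (tS' : forall n x, x = t' n.+1 (d' n.+1 x) + d' n (t' n x)).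

(* t (x) 1 + (e r) (x) t' contracts the total complex onto the augmentation:
   the first term retracts it onto the column p = 0, where e r is a projection
   onto the image of V, and the second contracts that column. *)
Definition total_contraction (x : P) : P := fun i =>
  let: (p, q) := i return X i.1 i.2 in
  tmap (t p) idfun (x (p.+1, q) : tensor (U p.+1) (U' q)) +
  match p return tensor (U p) (U' q) with
  | 0 => tmap (e \o r) (t' q) (x (0, q.+1)%N : tensor (U 0) (U' q.+1))
  | _ => 0
  end.

Definition corner (u : tensor (U 0) (U' 0)) : P := fun i =>
  match i return X i.1 i.2 with (0, 0)%N => u | _ => 0 end.

Lemma total_contractionP (x : P) : @total_diff_fun k X x = 0 ->
  x = @total_diff_fun k X (total_contraction x) +
      corner (tmap (e \o r) (e' \o r') (x (0, 0)%N)).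
Proof.
move=> Dx0.
have D0 p q : hdiff_to (X := X) p q x + vdiff_to (X := X) p q x = 0.
  exact: (congr1 (fun y : P => y (p, q)) Dx0).
(* The cocycle equation contracted by [t] trades [t d x] for a vertical term, with exactly the sign
   that the total differential gives to [d' t x]. *)
have Kt p q : tmap (t p) idfun (hdiff_to (X := X) p.+1 q x) +
    tmap (t p) idfun (vdiff_to (X := X) p.+1 q x) = 0 :> tensor (U p) (U' q).
  by rewrite -linearD D0 linear0.
have vd0 q : tmap idfun (d' q) (x (0, q)%N) = 0.
  by have := D0 0%N q.+1; rewrite /= expr0 scale1r add0r.
have split0 q : x (0, q)%N = tmap (t 0) idfun (tmap (d 0) idfun (x (0, q)%N)) +
    tmap (e \o r) idfun (x (0, q)%N).
  rewrite tmap_comp -[LHS]tmap_id; apply: tmapDl; exact: t0.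
have splitS p q : x (p.+1, q) =
    tmap (t p.+1) idfun (tmap (d p.+1) idfun (x (p.+1, q))) +
    tmap (d p) idfun (tmap (t p) idfun (x (p.+1, q))).
  rewrite !tmap_comp -[LHS]tmap_id; apply: tmapDl; exact: tS.
(* As [d 0] vanishes on the image of [e], the extra term of the contraction on column 0 does not
   reach column 1. *)
have h_er q u : tmap (d 0) idfun (tmap (e \o r) (t' q) u) = 0.
  by rewrite tmap_comp; apply: tmap0l => v; apply: de.
apply: functional_extensionality_dep => -[[|p] [|q]].
- rewrite -[RHS]/(0 + 0 + tmap (e \o r) (e' \o r') (x (0, 0)%N)) !add0r.
  have h0 : tmap (d 0) idfun (x (0, 0)%N) = 0.
    by have := D0 1%N 0%N; rewrite /= addr0.
  rewrite {1}split0 h0 linear0 add0r.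
  rewrite (@tmapDr _ _ _ _ (e \o r) idfun (t' 0 \o d' 0) (e' \o r')); last exact: t0'.
  by rewrite -[X in X + _](tmap_comp idfun (d' 0) (e \o r) (t' 0)) vd0 linear0 add0r.
- rewrite -[RHS]/(0 + (-1) ^+ 0 *: tmap idfun (d' q) (tmap (t 0) idfun (x (1, q)%N) +
    tmap (e \o r) (t' q) (x (0, q.+1)%N)) + 0) expr0 scale1r add0r addr0 linearD.
  rewrite {1}split0; congr (_ + _).
    have /eqP := Kt 0%N q.+1; rewrite addr_eq0 => /eqP -> /=.
    rewrite expr1 scaleN1r linearN opprK !tmap_comp; exact: eq_tmap.
  rewrite (@tmapDr _ _ _ _ (e \o r) idfun (t' q.+1 \o d' q.+1) (d' q \o t' q));
    last exact: tS'.
  rewrite -[X in X + _](tmap_comp idfun (d' q.+1) (e \o r) (t' q.+1)) vd0 linear0 add0r.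
  rewrite tmap_comp; exact: eq_tmap.
- have hc : tmap (d p) idfun (total_contraction x (p, 0%N)) =
      tmap (d p) idfun (tmap (t p) idfun (x (p.+1, 0%N))).
    rewrite [LHS]linearD; case: p => [|p]; first by rewrite h_er addr0.
    by rewrite linear0 addr0.
  rewrite -[RHS]/(tmap (d p) idfun (total_contraction x (p, 0%N)) + 0 + 0) hc !addr0.
  have h0 : tmap (d p.+1) idfun (x (p.+1, 0%N)) = 0.
    by have := D0 p.+2 0%N; rewrite /= addr0.
  by rewrite {1}splitS h0 linear0 add0r.
have hc : tmap (d p) idfun (total_contraction x (p, q.+1)) =
    tmap (d p) idfun (tmap (t p) idfun (x (p.+1, q.+1))).
  rewrite [LHS]linearD; case: p => [|p]; first by rewrite h_er addr0.
  by rewrite linear0 addr0.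
rewrite -[RHS]/(tmap (d p) idfun (total_contraction x (p, q.+1)) + (-1) ^+ p.+1 *:
  tmap idfun (d' q) (tmap (t p.+1) idfun (x (p.+2, q)) + 0) + 0) hc !addr0.
rewrite {1}splitS addrC; congr (_ + _).
have /eqP := Kt p.+1 q.+1; rewrite addr_eq0 => /eqP -> /=.
rewrite [in LHS]exprS mulN1r scaleNr linearN opprK linearZ; congr (_ *: _).
rewrite !tmap_comp; exact: eq_tmap.
Qed.

End TensorTotal.

Section ProductBimodule.
Variables (k : fieldType) (C : coalgebra k) (I : Type) (B : I -> bimod C).

Let P : lmodType k := dprod (fun i => B i : lmodType k).

Definition prod_lact_fun (a : dual C) (x : P) : P := fun i => lact a (x i).
Definition prod_ract_fun (x : P) (a : dual C) : P := fun i => ract (x i) a.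

Fact prod_lact_bilinear : bilinear_for *:%R *:%R prod_lact_fun.
Proof.
by split=> [x|a] c y z; apply: functional_extensionality_dep => i;
  [apply: linearPl|apply: linearPr].
Qed.

Fact prod_ract_bilinear : bilinear_for *:%R *:%R prod_ract_fun.
Proof.
by split=> [a|x] c y z; apply: functional_extensionality_dep => i;
  [apply: linearPl|apply: linearPr].
Qed.

Definition prod_lact := bilinear_of prod_lact_bilinear.
Definition prod_ract := bilinear_of prod_ract_bilinear.

Fact prod_lactM a b x : prod_lact (a * b) x = prod_lact a (prod_lact b x).
Proof. by apply: functional_extensionality_dep => i; apply: lactM. Qed.
Fact prod_lact1 x : prod_lact 1 x = x.
Proof. by apply: functional_extensionality_dep => i; apply: lact1. Qed.
Fact prod_ractM a b x : prod_ract x (a * b) = prod_ract (prod_ract x a) b.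
Proof. by apply: functional_extensionality_dep => i; apply: ractM. Qed.
Fact prod_ract1 x : prod_ract x 1 = x.
Proof. by apply: functional_extensionality_dep => i; apply: ract1. Qed.
Fact prod_lractA a b x : prod_ract (prod_lact a x) b = prod_lact a (prod_ract x b).
Proof. by apply: functional_extensionality_dep => i; apply: lractA. Qed.

Definition prod_bimod : bimod C := @Bimod k C P prod_lact prod_ract
  prod_lactM prod_lact1 prod_ractM prod_ract1 prod_lractA.

End ProductBimodule.

Section TensorHom.
Variables (k : fieldType) (C : coalgebra k).

Lemma tmap_bimod_hom (M M' : rcomod C) (N N' : lcomod C)
    (f : {linear M -> M'}) (g : {linear N -> N'}) :
  rcomod_hom f -> lcomod_hom g ->
  @bimod_hom k C (tensor_bimod M N) (tensor_bimod M' N') (tmap f g).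
Proof.
move=> fH gH a t; split.
  rewrite -[LHS]/(tmap f g (tmap _ _ t)) -[RHS]/(tmap _ _ (tmap f g t)) !tmap_comp.
  apply: eq_tmap => // m /=; rewrite /rcomod_act /= fH contr_r_tmap.
  by congr (f (contr_r _ _)); apply: dual_ext.
rewrite -[LHS]/(tmap f g (tmap _ _ t)) -[RHS]/(tmap _ _ (tmap f g t)) !tmap_comp.
apply: eq_tmap => // m /=; rewrite /lcomod_act /= gH contr_l_tmap.
by congr (g (contr_l _ _)); apply: dual_ext.
Qed.

(** Contracting the middle factor with [a] turns [rcoact (x) 1] and [1 (x) lcoact] into the left and
    right actions of [a]. *)
Lemma cotensor_sub_center (M : rcomod C) (N : lcomod C) (t : tensor M N) :
  t \in cotensor_sub M N <-> t \in center (tensor_bimod M N).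
Proof.
have lE a : tmap idfun (contr_l a) (tassoc (tmap rcoact idfun t)) =
    tmap (rcomod_act M a) idfun t.
  apply: (tens_eq (f := tmap idfun (contr_l a) \o tassoc \o tmap rcoact idfun)) => m n.
  rewrite -[LHS]/(tmap _ _ (tassoc (tmap _ _ (tens m n)))) !tmapE /=.
  apply: (tens_eq (f := tmap idfun (contr_l a) \o tassoc \o tensr (tensor M C) n)
    (g := tensr M n \o contr_r a)) => v c.
  rewrite -[LHS]/(tmap _ _ (tassoc (tens (tens v c) n))) tassocE tmapE contr_lE.
  by rewrite -[RHS]/(tens (contr_r a (tens v c)) n) contr_rE linearZl_LR linearZr_LR.
have rE a : tmap idfun (contr_l a) (tmap idfun lcoact t) =
    tmap idfun (lcomod_act N a) t.
  by rewrite tmap_comp; apply: eq_tmap.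
split=> [/cotensorP tE|/asboolP tE].
  apply/asboolP => a; rewrite -[LHS]/(tmap (rcomod_act M a) idfun t).
  by rewrite -[RHS]/(tmap idfun (lcomod_act N a) t) -lE -rE tE.
apply/cotensorP; apply: tensor_separation_middle => a; rewrite lE rE.
exact: (tE a).
Qed.

End TensorHom.

(** * The total complex as an injective resolution of the tensor product *)

Section TotalResolution.
Variables (k : fieldType) (C : coalgebra k) (M : rcomod C) (N : lcomod C).
Variables (E1 : rcomod_injres M) (E2 : lcomod_injres N).

Definition E1_space n : lmodType k := (E1 n : rcomod C).
Definition E2_space n : lmodType k := (E2 n : lcomod C).
Definition E1_aug : {linear M -> E1_space 0} := raug E1.
Definition E2_aug : {linear N -> E2_space 0} := raug E2.
Definition E1_diff n : {linear E1_space n -> E1_space n.+1} := rdiff E1 n.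
Definition E2_diff n : {linear E2_space n -> E2_space n.+1} := rdiff E2 n.

Fact E1_diffK n x : E1_diff n.+1 (E1_diff n x) = 0.
Proof. exact: (rdiffK (K := rcomod_cat C)). Qed.
Fact E2_diffK n x : E2_diff n.+1 (E2_diff n x) = 0.
Proof. exact: (rdiffK (K := lcomod_cat C)). Qed.

Definition res_bicpx : bicomplex k := tensor_bicomplex E1_diffK E2_diffK.

Definition res_tensor (i : nat * nat) : bimod C :=
  tensor_bimod (E1 i.1 : rcomod C) (E2 i.2 : lcomod C).

(** The [n]-th term of the total complex, retyped inside the product bimodule, so that [total_diff]
    is by conversion a map between the bimodules [tot_bimod]. *)
Definition tot_sub n : submodClosed (prod_bimod res_tensor) :=
  (@total_pred k res_bicpx n : submodClosed (dprod (fun i => res_bicpx i.1 i.2))).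

Lemma tot_subP n (x : prod_bimod res_tensor) :
  x \in tot_sub n <-> forall i, (i.1 + i.2)%N != n -> x i = 0.
Proof. by split=> [/asboolP|?] //; apply/asboolP. Qed.

Fact tot_lact n (a : dual C) (x : prod_bimod res_tensor) :
  x \in tot_sub n -> lact a x \in tot_sub n.
Proof.
move=> /tot_subP xn; apply/tot_subP => i ni.
by rewrite -[LHS]/(lact a (x i)) xn ?linear0r.
Qed.

Fact tot_ract n (a : dual C) (x : prod_bimod res_tensor) :
  x \in tot_sub n -> ract x a \in tot_sub n.
Proof.
move=> /tot_subP xn; apply/tot_subP => i ni.
by rewrite -[LHS]/(ract (x i) a) xn ?linear0l.
Qed.

Definition tot_bimod n : bimod C := sub_bimod (@tot_lact n) (@tot_ract n).

(** Only the finitely many positions [(p, n - p)] carry nonzero components, so finitely many lists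
    are concatenated; an infinite product would admit no such list in general. *)
Lemma tot_bimod_rational n : rational (tot_bimod n).
Proof.
apply/rational_seqP => x.
have ratE i : rational (res_tensor i) by apply: tensor_bimod_rational.
have /choice[s sP] i := proj1 (rational_seqP (res_tensor i)) (ratE i) (incl x i).
exists (flatten [seq s (p, (n - p)%N) | p <- iota 0 n.+1]) => a a0.
have H i : lact a (incl x i) = 0 /\ ract (incl x i) a = 0.
  have /tot_subP xn := inclP x.
  have [pq|/xn ->] := eqVneq (i.1 + i.2)%N n; last by rewrite linear0r linear0l.
  apply: sP => c cs; apply: a0; apply/flattenP; exists (s i) => //.
  have -> : i = (i.1, n - i.1)%N by rewrite -pq addKn; case: (i).
  apply: (map_f (fun p => s (p, (n - p)%N))).
  by rewrite mem_iota add0n ltnS -pq leq_addr.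
split; apply: incl_inj; rewrite linear0; apply: functional_extensionality_dep => i.
  exact: (H i).1.
exact: (H i).2.
Qed.

Lemma tot_bimod_injective n :
  @injective_obj k (bimod_cat C) (@rational k C) (tot_bimod n).
Proof.
split=> [|X Y i f ratX ratY iH i_inj fH]; first exact: tot_bimod_rational.
have injE j : @injective_obj k (bimod_cat C) (@rational k C) (res_tensor j).
  by apply: tensor_bimod_injective; apply: rterm_injective.
have f_lin j : linear (fun x => incl (f x) j : res_tensor j).
  by move=> a x y; rewrite linearP.
have g_ex j : exists g : {linear (Y : bimod C) -> res_tensor j},
    bimod_hom g /\ forall x, g (i x) = incl (f x) j.
  have [|g gH gE] := (injE j).2 X Y i (linear_of (f_lin j)) ratX ratY iH i_inj.
    move=> a x; split.
      by rewrite -[LHS]/(incl (f (lact a x)) j) (fH a x).1.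
    by rewrite -[LHS]/(incl (f (ract x a)) j) (fH a x).2.
  by exists g; split=> // x; rewrite gE.
pose g j := sval (cid (g_ex j)).
have gH j : bimod_hom (g j) := (svalP (cid (g_ex j))).1.
have gE j x : g j (i x) = incl (f x) j := (svalP (cid (g_ex j))).2 x.
(* The componentwise extensions are cut to 0 off the diagonal of degree [n], where the components of
   [f] vanish as well. *)
pose h (y : (Y : bimod C)) : prod_bimod res_tensor :=
  fun j => if (j.1 + j.2)%N == n then g j y else 0.
have h_tot y : h y \in tot_sub n.
  by apply/tot_subP => j /negbTE nj; rewrite /h nj.
have h_lin : linear (fun y => subsp_of (h_tot y) : tot_bimod n).
  move=> a y z; apply: incl_inj; apply: functional_extensionality_dep => j.
  rewrite linearP /= -[RHS]/(a *: h y j + h z j) /h.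
  by case: ifP => _; rewrite ?linearP // scaler0 addr0.
exists (linear_of h_lin) => [a y|x].
  split; apply: incl_inj; apply: functional_extensionality_dep => j.
    rewrite -[LHS]/(h (lact a y) j) -[RHS]/(lact a (h y j)) /h.
    by case: ifP => _; rewrite ?(gH j a y).1 ?linear0r.
  rewrite -[LHS]/(h (ract y a) j) -[RHS]/(ract (h y j) a) /h.
  by case: ifP => _; rewrite ?(gH j a y).2 ?linear0l.
apply: incl_inj; apply: functional_extensionality_dep => j.
rewrite -[LHS]/(h (i x) j) /h; case: eqP => [_|/eqP nj]; first exact: gE.
by have /tot_subP/(_ j nj) := inclP (f x).
Qed.

Definition tot_diff n : {linear tot_bimod n -> tot_bimod n.+1} :=
  @total_diff k res_bicpx n.

Lemma tot_diff_hom n : bimod_hom (@tot_diff n).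
Proof.
have hH p q :
    @bimod_hom k C (res_tensor (p, q)) (res_tensor (p.+1, q)) (hdiff res_bicpx p q).
  exact: (tmap_bimod_hom (rdiff_hom E1 p) (@lcomod_hom_id k C (E2 q))).
have vH p q :
    @bimod_hom k C (res_tensor (p, q)) (res_tensor (p, q.+1)) (vdiff res_bicpx p q).
  exact: (tmap_bimod_hom (@rcomod_hom_id k C (E1 p)) (rdiff_hom E2 q)).
move=> a x; split; apply: incl_inj; apply: functional_extensionality_dep => -[p q].
  pose ax i := lact a (incl x i : res_tensor i).
  rewrite -[LHS]/(hdiff_to (X := res_bicpx) p q ax + vdiff_to (X := res_bicpx) p q ax).
  rewrite -[RHS]/(lact a (hdiff_to (X := res_bicpx) p q (incl x) +
    vdiff_to (X := res_bicpx) p q (incl x) : res_tensor (p, q))) linearDr.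
  congr (_ + _).
    by case: p => [|p]; rewrite /= ?linear0r // (hH p q a _).1.
  by case: q => [|q]; rewrite /= ?linear0r // (vH p q a _).1 linearZr_LR.
pose xa i := ract (incl x i : res_tensor i) a.
rewrite -[LHS]/(hdiff_to (X := res_bicpx) p q xa + vdiff_to (X := res_bicpx) p q xa).
rewrite -[RHS]/(ract (hdiff_to (X := res_bicpx) p q (incl x) +
  vdiff_to (X := res_bicpx) p q (incl x) : res_tensor (p, q)) a) linearDl.
congr (_ + _).
  by case: p => [|p]; rewrite /= ?linear0l // (hH p q a _).2.
by case: q => [|q]; rewrite /= ?linear0l // (vH p q a _).2 linearZl_LR.
Qed.

Definition corner_aug (u : tensor M N) : prod_bimod res_tensor :=
  corner E1_diffK E2_diffK (tmap E1_aug E2_aug u)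
    : dprod (fun i => res_bicpx i.1 i.2).

Lemma corner_aug_tot u : corner_aug u \in tot_sub 0.
Proof. by apply/tot_subP => -[[|p] [|q]]. Qed.

Fact tot_aug_linear : linear (fun u => subsp_of (corner_aug_tot u) : tot_bimod 0).
Proof.
move=> a u v; apply: incl_inj; rewrite linearP !subsp_ofK.
apply: functional_extensionality_dep => -[p q].
rewrite -[RHS]/(a *: corner_aug u (p, q) + corner_aug v (p, q)).
case: p q => [|p] [|q]; rewrite ?scaler0 ?addr0 //.
exact: linearP.
Qed.

Definition tot_aug : {linear tensor_bimod M N -> tot_bimod 0} := linear_of tot_aug_linear.

Lemma tot_aug_hom : bimod_hom tot_aug.
Proof.
have H : @bimod_hom k C (tensor_bimod M N) (res_tensor (0, 0)%N)
    (tmap E1_aug E2_aug).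
  exact: (tmap_bimod_hom (raug_hom E1) (raug_hom E2)).
move=> a u; split; apply: incl_inj; apply: functional_extensionality_dep => -[p q].
  rewrite -[LHS]/(corner_aug (lact a u) (p, q)) -[RHS]/(lact a (corner_aug u (p, q))).
  case: p q => [|p] [|q]; rewrite ?linear0r //; exact: (H a u).1.
rewrite -[LHS]/(corner_aug (ract u a) (p, q)) -[RHS]/(ract (corner_aug u (p, q)) a).
case: p q => [|p] [|q]; rewrite ?linear0l //; exact: (H a u).2.
Qed.

Lemma E1_contraction :
  exists (r : {linear E1_space 0 -> M})
      (t : forall n, {linear E1_space n.+1 -> E1_space n}),
    (forall x, x = t 0 (E1_diff 0 x) + E1_aug (r x)) /\
    (forall n x, x = t n.+1 (E1_diff n.+1 x) + E1_diff n (t n x)).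
Proof.
apply: exact_contraction.
- exact: (@raug_injective _ _ _ _ E1).
- exact: (@raug_exact _ _ _ _ E1).
- exact: (@rdiff_exact _ _ _ _ E1).
Qed.

Lemma E2_contraction :
  exists (r : {linear E2_space 0 -> N})
      (t : forall n, {linear E2_space n.+1 -> E2_space n}),
    (forall x, x = t 0 (E2_diff 0 x) + E2_aug (r x)) /\
    (forall n x, x = t n.+1 (E2_diff n.+1 x) + E2_diff n (t n x)).
Proof.
apply: exact_contraction.
- exact: (@raug_injective _ _ _ _ E2).
- exact: (@raug_exact _ _ _ _ E2).
- exact: (@rdiff_exact _ _ _ _ E2).
Qed.

Lemma tot_aug_injective : injective tot_aug.
Proof.
have [r1 r1K] := @linear_retraction k _ _ E1_aug (@raug_injective _ _ _ _ E1).
have [r2 r2K] := @linear_retraction k _ _ E2_aug (@raug_injective _ _ _ _ E2).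
move=> u v /(congr1 (fun x : tot_bimod 0 => incl x (0, 0)%N)) uv.
have K z : tmap r1 r2 (corner_aug z (0, 0)%N) = z.
  rewrite -[corner_aug z _]/(tmap E1_aug
    E2_aug z) tmap_comp -[RHS]tmap_id.
  exact: eq_tmap.
by rewrite -[u]K -[v]K; congr (tmap r1 r2 _).
Qed.

Lemma E1_diff_aug v : E1_diff 0 (E1_aug v) = 0.
Proof. by apply: (proj2 (@raug_exact _ _ _ _ E1 _)); exists v. Qed.
Lemma E2_diff_aug v : E2_diff 0 (E2_aug v) = 0.
Proof. by apply: (proj2 (@raug_exact _ _ _ _ E2 _)); exists v. Qed.

Lemma tot_aug_exact y : tot_diff 0 y = 0 <-> exists x, y = tot_aug x.
Proof.
split=> [/(congr1 incl) Dy|[u ->]]; last first.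
  apply: incl_inj; rewrite linear0; apply: functional_extensionality_dep => -[p q].
  rewrite -[LHS]/(hdiff_to (X := res_bicpx) p q (corner_aug u) +
    vdiff_to (X := res_bicpx) p q (corner_aug u)) -[RHS]/0.
  have -> : hdiff_to (X := res_bicpx) p q (corner_aug u) = 0.
    case: p q => [|[|p]] [|q] //=; rewrite ?linear0 //.
    rewrite tmap_comp; apply: tmap0l; exact: E1_diff_aug.
  rewrite add0r; case: p q => [|p] [|[|q]] //=; rewrite ?linear0 ?scaler0 //.
  by rewrite expr0 scale1r tmap_comp; apply: tmap0r; exact: E2_diff_aug.
have [r1 [t1 [t10 t1S]]] := E1_contraction.
have [r2 [t2 [t20 t2S]]] := E2_contraction.
pose z : dprod (fun i => res_bicpx i.1 i.2) := incl y.
have Dz : @total_diff_fun k res_bicpx z = 0 := Dy.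
have ztot : forall i, (i.1 + i.2)%N != 0%N -> z i = 0.
  exact: (proj1 (tot_subP 0%N _) (inclP y)).
have := total_contractionP E1_diff_aug t10 t1S t20 t2S Dz.
set H := total_contraction _ _ _ _ _.
(* The contraction lowers the total degree by one and [z] has degree 0, so [z] is its own corner
   term. *)
have -> : H = 0.
  apply: functional_extensionality_dep => -[p q].
  rewrite -[LHS]/(tmap _ _ (z (p.+1, q)) + _) ztot // linear0 add0r.
  by case: p => [|p] //=; rewrite ztot // linear0.
rewrite linear0 add0r => zE.
exists (tmap r1 r2 (z (0, 0)%N)); apply: incl_inj; apply: etrans zE _.
rewrite -[RHS]/(corner_aug _); congr corner.
by rewrite tmap_comp.
Qed.

Lemma tot_diff_exact n y : tot_diff n.+1 y = 0 <-> exists x, y = tot_diff n x.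
Proof.
split=> [/(congr1 incl) Dy|[u ->]]; last exact: (@total_diffK k res_bicpx n u).
have [r1 [t1 [t10 t1S]]] := E1_contraction.
have [r2 [t2 [t20 t2S]]] := E2_contraction.
pose z : dprod (fun i => res_bicpx i.1 i.2) := incl y.
have Dz : @total_diff_fun k res_bicpx z = 0 := Dy.
have ztot : forall i, (i.1 + i.2)%N != n.+1 -> z i = 0.
  exact: (proj1 (tot_subP n.+1 _) (inclP y)).
have := total_contractionP E1_diff_aug t10 t1S t20 t2S Dz.
set H := total_contraction _ _ _ _ _.
have Htot : H \in tot_sub n.
  apply/tot_subP => -[p q] pq.
  rewrite -[LHS]/(tmap _ _ (z (p.+1, q)) + _) ztot //= linear0 add0r.
  by case: p pq => [|p] //= pq; rewrite ztot // linear0.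
(* The position (0, 0) is outside degree [n.+1], so the corner term vanishes. *)
rewrite ztot // linear0 => zE.
exists (subsp_of Htot); apply: incl_inj; apply: etrans zE _.
rewrite -[RHS]/(total_diff_fun H) -[RHS]addr0; congr (_ + _).
by apply: functional_extensionality_dep => -[[|p] [|q]].
Qed.

Definition tot_injres : rational_injres (tensor_bimod M N) :=
  @InjRes k (bimod_cat C) (@rational k C) (tensor_bimod M N) tot_bimod tot_aug tot_diff
    tot_bimod_injective tot_aug_hom tot_diff_hom tot_aug_injective
    tot_aug_exact tot_diff_exact.

End TotalResolution.

(** * Cotensor products as centers, and the conclusion *)

Section CotorCenter.
Variables (k : fieldType).

Lemma lin_iso_cohomology_bij (X Y : cochain k) (f : forall n, {linear X n -> Y n}) :
  (forall n x, f n.+1 (cdiff X n x) = cdiff Y n (f n x)) ->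
  (forall n, injective (f n)) -> (forall n y, exists x, f n x = y) ->
  forall n, lin_iso (cohomology X n) (cohomology Y n).
Proof.
move=> fd f_inj f_surj n; apply: (lin_iso_cohomology (f := f n)) => [x x0|x _|y y0].
- by rewrite -fd x0 linear0.
- case: n x => [|n] x /=; split=> fx.
  + by rewrite fx linear0.
  + by apply: f_inj; rewrite fx linear0.
  + by case: fx => y ->; exists (f n y); apply: fd.
  by case: fx => y; have [z <-] := f_surj n y; rewrite -fd => /f_inj ->; exists z.
have [x xy] := f_surj n y; exists x; first by apply: f_inj; rewrite fd xy y0 linear0.
by rewrite xy subrr; case: (n) => //= m; exists 0; rewrite linear0.
Qed.

Variables (C : coalgebra k) (M : rcomod C) (N : lcomod C).
Variables (E1 : rcomod_injres M) (E2 : lcomod_injres N).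

Local Notation cotensor_bicpx := (cotensor_bicomplex E1 E2).
Local Notation cotensor_fam := (dprod (fun i => cotensor_bicpx i.1 i.2)).
Local Notation res_tensor := (res_tensor E1 E2).

(** A family is central exactly when each component is, so componentwise inclusion will identify the
    two complexes. *)
Definition cotensor_incl (x : cotensor_fam) : prod_bimod res_tensor :=
  fun i => incl (x i : cotensor (E1 i.1 : rcomod C) (E2 i.2 : lcomod C)).

Lemma cotensor_incl_tot n (x : total cotensor_bicpx n) :
  cotensor_incl (incl x) \in tot_sub E1 E2 n.
Proof.
apply/tot_subP => i ni; have /asboolP/(_ i ni) xi := inclP x.
by rewrite /cotensor_incl xi linear0.
Qed.

Definition cotensor_to_tot n (x : total cotensor_bicpx n) : tot_bimod E1 E2 n :=
  subsp_of (cotensor_incl_tot x).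

Lemma cotensor_to_tot_center n (x : total cotensor_bicpx n) :
  cotensor_to_tot x \in center (tot_bimod E1 E2 n).
Proof.
apply/asboolP => a; apply: incl_inj; apply: functional_extensionality_dep => i.
by have /cotensor_sub_center/asboolP/(_ a) := inclP (incl x i : cotensor _ _).
Qed.

Definition cotensor_to_center_fun n (x : total cotensor_bicpx n) :
    center_complex (tot_injres E1 E2) n := subsp_of (cotensor_to_tot_center x).

Fact cotensor_to_center_linear n : linear (@cotensor_to_center_fun n).
Proof.
move=> a x y; apply: incl_inj; rewrite [RHS]linearP; apply: incl_inj.
rewrite [RHS]linearP; apply: functional_extensionality_dep => i.
rewrite -[LHS]/(incl (incl (a *: x + y) i : cotensor _ _)).
by rewrite linearP -[LHS]/(incl (a *: incl x i + incl y i : cotensor _ _)) linearP.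
Qed.

Definition cotensor_to_center n := linear_of (@cotensor_to_center_linear n).

Lemma cotensor_to_center_inj n : injective (cotensor_to_center n).
Proof.
move=> x y xy; apply: incl_inj; apply: functional_extensionality_dep => i.
apply: incl_inj.
exact: (congr1 (fun z : center_complex (tot_injres E1 E2) n =>
  (incl (incl z : tot_bimod E1 E2 n) : prod_bimod res_tensor) i) xy).
Qed.

Lemma cotensor_to_center_surj n y : exists x, cotensor_to_center n x = y.
Proof.
pose z : prod_bimod res_tensor := incl (incl y : tot_bimod E1 E2 n).
have zC i : (z i : tensor_bimod _ _) \in
    cotensor_sub (E1 i.1 : rcomod C) (E2 i.2 : lcomod C).
  apply/cotensor_sub_center/asboolP => a.
  have /asboolP/(_ a) := inclP y.
  exact: (congr1 (fun u : tot_bimod E1 E2 n => (incl u : prod_bimod res_tensor) i)).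
pose x0 : cotensor_fam := fun i => subsp_of (zC i).
have x0n : x0 \in @total_pred k cotensor_bicpx n.
  apply/asboolP => i ni; apply: incl_inj.
  rewrite linear0 -[LHS]/(z i); have /tot_subP := inclP (incl y : tot_bimod E1 E2 n).
  exact.
by exists (subsp_of x0n); do 2!apply: incl_inj.
Qed.

Lemma cotensor_to_center_diff n (x : total cotensor_bicpx n) :
  cotensor_to_center _ (cdiff (total cotensor_bicpx) n x) =
  cdiff (center_complex (tot_injres E1 E2)) n (cotensor_to_center n x).
Proof.
do 2!apply: incl_inj; apply: functional_extensionality_dep => -[p q].
rewrite -[LHS]/(incl (hdiff_to (X := cotensor_bicpx) p q (incl x) +
  vdiff_to (X := cotensor_bicpx) p q (incl x) : cotensor _ _)) linearD.
rewrite -[RHS]/(hdiff_to (X := res_bicpx E1 E2) p q (cotensor_incl (incl x)) +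
  vdiff_to (X := res_bicpx E1 E2) p q (cotensor_incl (incl x))); congr (_ + _).
  by case: p => [|p] /=; rewrite ?linear0.
by case: q => [|q] /=; rewrite ?linear0 // linearZ.
Qed.

Lemma Cotor_Hctn_tot n : lin_iso (Cotor E1 E2 n) (Hctn (tot_injres E1 E2) n).
Proof.
apply: lin_iso_cohomology_bij cotensor_to_center_diff _ _ n.
- exact: cotensor_to_center_inj.
- exact: cotensor_to_center_surj.
Qed.

End CotorCenter.

Theorem theorem4p11 (k : fieldType) (C : coalgebra k) (M : rcomod C) (N : lcomod C)
    (E1 : rcomod_injres M) (E2 : lcomod_injres N)
    (J : rational_injres (tensor_bimod M N)) (n : nat) :
  lin_iso (Cotor E1 E2 n) (Hctn J n).
Proof.
exact: lin_iso_trans (Cotor_Hctn_tot E1 E2 n) (Hctn_unique (tot_injres E1 E2) J n).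
Qed.
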